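(* Let $f$ be a pairwise loss such that for all $z,z'\in\mathcal{Z}$ the map $\mathbf{w}\mapsto f(\mathbf{w};z,z')$ is convex and $G$-Lipschitz on $\mathcal{W}$. Let $\beta\in(0,1)$, $\epsilon>0$, $\delta\in(0,1)$, and let $\sigma^2=\frac{56G^2T}{\beta n^2\epsilon}\big(\frac{\log(1/\delta)}{(1-\beta)\epsilon}+1\big)$ be the noise variance of Algorithm 2 (described in the context) run for $T$ iterations on a dataset of size $n$. Set $\lambda=\frac{\log(1/\delta)}{(1-\beta)\epsilon}+1$. If $\sigma^2\ge2.68G^2$ and $$\lambda-1\le\frac{\sigma^2}{6G^2}\log\Big(\frac{n}{2\lambda\big(1+\frac{\sigma^2}{4G^2}\big)}\Big),$$ then Algorithm 2 satisfies $(\epsilon,\delta)$-differential privacy.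
   Context: Data space $\mathcal{Z}=\mathcal{X}\times\mathcal{Y}$, $\mathcal{X}\subset\mathbb{R}^d$, $\mathcal{Y}\subset\mathbb{R}$; $\mathcal{W}\subseteq\mathbb{R}^d$ convex; pairwise loss $f:\mathcal{W}\times\mathcal{Z}\times\mathcal{Z}\to\mathbb{R}$ with (sub)gradient $\partial f(\mathbf{w};z,z')$ in $\mathbf{w}$. $G$-Lipschitz means $|f(\mathbf{w};z,z')-f(\mathbf{w}';z,z')|\le G\|\mathbf{w}-\mathbf{w}'\|_2$. Algorithm 2 (DP-SGD for pairwise learning): input dataset $S=\{z_1,\dots,z_n\}$, step sizes $\{\eta_t\}$, $\epsilon,\delta,\beta,G,T$. Set $\mathbf{w}_1=\mathbf{0}$. For $t=1,\dots,T$: sample $(i_t,j_t)$ uniformly over all ordered pairs $\{(i,j):i,j\in[n],i\ne j\}$, draw $\mathbf{b}_t\sim\mathcal{N}(0,\sigma^2\mathbf{I}_d)$ with $\sigma^2=\frac{56G^2T}{\beta n^2\epsilon}\big(\frac{\log(1/\delta)}{(1-\beta)\epsilon}+1\big)$ (all independent), and set $\mathbf{w}_{t+1}=\mathrm{Proj}_{\mathcal{W}}(\mathbf{w}_t-\eta_t(\partial f(\mathbf{w}_t;z_{i_t},z_{j_t})+\mathbf{b}_t))$. Output $\mathbf{w}_{\mathrm{priv}}=\frac1T\sum_{t=1}^T\mathbf{w}_t$. A randomized algorithm $\mathcal{A}$ is $(\epsilon,\delta)$-differentially private if for any two datasets $S,S'$ of size $n$ differing in exactly one data point and any measurable event $E$,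 $\mathbb{P}(\mathcal{A}(S)\in E)\le e^\epsilon\mathbb{P}(\mathcal{A}(S')\in E)+\delta$.
   Formalization: The (sub)gradients used by Algorithm 2 are additionally assumed to satisfy ‖∂f(w;z,z')‖ ≤ G on W (Lipschitz continuity on W alone does not bound subgradients at boundary points, where privacy can fail), to be measurable in w, and 0 ∈ W. *)

(* Defs.v *)
From HB Require Import structures.
From mathcomp Require Import all_boot all_order all_algebra.
From mathcomp Require Import all_classical all_reals all_analysis.
From mathcomp Require Import normal_distribution.

Set Implicit Arguments.
Unset Strict Implicit.
Unset Printing Implicit Defensive.

Import Order.TTheory GRing.Theory Num.Theory.
Local Open Scope classical_set_scope.
Local Open Scope ring_scope.

Section Defs.
Context {R : realType}.

Definition vdot (dim : nat) (u v : 'rV[R]_dim) : R := \sum_(i < dim) u ord0 i * v ord0 i.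
Definition vnorm (dim : nat) (v : 'rV[R]_dim) : R := Num.sqrt (vdot v v).

Definition convex_subset (dim : nat) (W : set 'rV[R]_dim) : Prop :=
  forall u v t, W u -> W v -> 0 <= t <= 1 -> W (t *: u + (1 - t) *: v).

Definition convex_on (dim : nat) (W : set 'rV[R]_dim) (h : 'rV[R]_dim -> R) : Prop :=
  forall u v t, W u -> W v -> 0 <= t <= 1 ->
    h (t *: u + (1 - t) *: v) <= t * h u + (1 - t) * h v.

(* Borel sigma-algebra of R^dim: generated by the coordinate cylinders
   (equal to the product of the Borel sigma-algebras of R). *)
Definition rV_cylinders (dim : nat) : set (set 'rV[R]_dim) :=
  [set E | exists (i : 'I_dim) (A : set R), measurable A /\ E = [set v : 'rV[R]_dim | A (v ord0 i)]].

Definition rV_borel (dim : nat) (E : set 'rV[R]_dim) : Prop :=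
  <<s @rV_cylinders dim >> E.

Definition rV_measurable_fun (dim : nat) (h : 'rV[R]_dim -> 'rV[R]_dim) : Prop :=
  forall E, rV_borel E -> rV_borel (h @^-1` E).

Definition mutually_independent {d} {Omega : measurableType d}
    (P : probability Omega R) (K : eqType) (C : K -> set (set Omega)) : Prop :=
  forall (s : seq K) (A : K -> set Omega), uniq s ->
    (forall k, k \in s -> C k (A k)) ->
    P (\big[setI/setT]_(k <- s) A k) = (\prod_(k <- s) fine (P (A k)))%:E.

Definition datum (dim : nat) := ('rV[R]_dim * R)%type.

(* The sigma-algebras generated by the sampled pair (i_t, j_t) and by each
   coordinate of the noise b_t; index inl t = pair at step t,
   inr (t, k) = k-th coordinate of b_t. *)
Definition alg2_classes {d} {Omega : measurableType d} (dim n : nat)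
    (IJ : nat -> Omega -> ('I_n * 'I_n)) (B : nat -> 'I_dim -> Omega -> R)
    (k : nat + (nat * 'I_dim)) : set (set Omega) :=
  match k with
  | inl t => [set IJ t @^-1` A | A in [set: set ('I_n * 'I_n)]]
  | inr tk => [set B tk.1 tk.2 @^-1` A | A in [set A : set R | measurable A]]
  end.

(* Iterates of Algorithm 2: alg2_iter k = w_{k+1}; w_1 = 0 and
   w_{t+1} = Proj_W (w_t - eta_t (g(w_t; z_{i_t}, z_{j_t}) + b_t)). *)
Fixpoint alg2_iter (dim n : nat) (proj : 'rV[R]_dim -> 'rV[R]_dim)
    (g : 'rV[R]_dim -> datum dim -> datum dim -> 'rV[R]_dim) (eta : nat -> R)
    (S : 'I_n -> datum dim) (IJ : nat -> 'I_n * 'I_n) (b : nat -> 'rV[R]_dim)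
    (k : nat) : 'rV[R]_dim :=
  match k with
  | 0%N => 0
  | k'.+1 =>
      let w := alg2_iter proj g eta S IJ b k' in
      proj (w - eta k *: (g w (S (IJ k).1) (S (IJ k).2) + b k))
  end.

Definition alg2_output {d} {Omega : measurableType d} (dim n : nat)
    (proj : 'rV[R]_dim -> 'rV[R]_dim)
    (g : 'rV[R]_dim -> datum dim -> datum dim -> 'rV[R]_dim) (eta : nat -> R)
    (T : nat) (IJ : nat -> Omega -> ('I_n * 'I_n)) (B : nat -> 'I_dim -> Omega -> R)
    (S : 'I_n -> datum dim) (omega : Omega) : 'rV[R]_dim :=
  T%:R^-1 *: \sum_(k < T)
     alg2_iter proj g eta S (fun t => IJ t omega) (fun t => \row_i B t i omega) k.

Definition alg2_sigma2 (G beta eps delta : R) (n T : nat) : R :=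
  56 * G ^+ 2 * T%:R / (beta * n%:R ^+ 2 * eps) *
  (ln (delta^-1) / ((1 - beta) * eps) + 1).

Definition differentially_private {d} {Omega : measurableType d} (dim n : nat)
    (P : probability Omega R) (Z : set (datum dim))
    (out : ('I_n -> datum dim) -> Omega -> 'rV[R]_dim) (eps delta : R) : Prop :=
  forall S S' : 'I_n -> datum dim,
    (forall i, Z (S i)) -> (forall i, Z (S' i)) ->
    (exists i, S i <> S' i /\ forall j, j != i -> S j = S' j) ->
    forall E, rV_borel E ->
      (P (out S @^-1` E) <= (expR eps)%:E * P (out S' @^-1` E) + delta%:E)%E.

End Defs.

(* Main.v *)
Require Import Defs.
From HB Require Import structures.
From mathcomp Require Import all_boot all_order all_algebra.
From mathcomp Require Import all_classical all_reals all_analysis.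
From mathcomp Require Import normal_distribution measurable_realfun.
From mathcomp Require Import ring lra.

Import Order.TTheory GRing.Theory Num.Theory.
Import numFieldNormedType.Exports.
Local Open Scope classical_set_scope.
Local Open Scope ring_scope.

(* For l > 1 the tangent line of x |-> x^l at r shows that a bound M on the l-th
   moment of the likelihood ratio of two laws mu, mu' amounts to
     l r^(l-1) mu(phi) <= M + (l-1) r^l mu'(phi)   (r > 0, 0 <= phi <= 1).
   This family of inequalities, and not the moment itself, is propagated
   backwards along the Markov chain (w_t, w_1 + ... + w_t): no density of the
   iterates is needed.  One step multiplies M by 1 + 7/2 q^2 l (l-1) tau, where
   q = 2/n is the probability that the sampled pair meets the index at which the
   datasets differ and tau = 4 G^2 / sigma^2: the Cameron-Martin formula turns the
   noisy gradients of a pair avoiding that index and of a pair meeting it into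
   likelihoods A and B with respect to the former, and a second-order Taylor
   estimate of (1-q+qA)^l (1-q+qB)^(1-l) has a linear part of mean zero.  With
   l = lambda the product over T steps is at most exp((l-1) beta eps), and
   r = e^eps l/(l-1) turns the tangent inequality into (eps, delta)-privacy. *)

(** * Elementary inequalities *)

(** The projection destroys densities, but each inequality of the family is linear in the pair of
    expectations: it survives composition with measurable maps and averaging over any coupling of
    the sampled pairs. Replacing r by r Y / X absorbs likelihoods X and Y at the price of X^l
    Y^(1-l). Applying convexity separately to the pairs that meet the index and to those that avoid
    it costs order q per step. The cost q^2 is reached only by measuring both laws of a meeting pair
    against the common law of an avoiding pair, and then the Taylor remainder involves moments of A
    and B of order up to max(l, 3). In terms of tau, the bound sigma^2 >= 2.68 G^2 gives tau <= 3/2,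
    and the logarithmic hypothesis is exactly q l exp(3/2 tau (l-1)) <= tau / (1 + tau), the
    smallness of q that keeps those moments under control. The constant 56 of the variance is 7/2 *
    4 * 4: the coefficient of the step, the 4 of q^2 = 4 / n^2 and the 4 of tau. What is left of the
    budget, (l-1)(1-beta) eps, equals log(1/delta). *)

Lemma eq_le_porder (R : numDomainType) (x y : R) : x = y -> x <= y.
Proof. by move=> ->. Qed.

Lemma expR_chord (R : realType) (a x : R) : 0 < a -> 0 <= x <= a ->
  expR x <= 1 + (expR a - 1) / a * x.
Proof.
move=> a0 /andP[x0 xa].
have t01 : 0 <= x / a <= 1 by apply/andP; split; [rewrite divr_ge0// ltW|rewrite ler_pdivrMr// mul1r].
have := @convex_expR R (Itv01 (proj1 (andP t01)) (proj2 (andP t01))) a 0.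
rewrite !convRE /= /unstable.onem expR0 mulr0 addr0 divfK ?gt_eqF// => /le_trans; apply.
by apply/eq_le_porder; field; rewrite gt_eqF.
Qed.

(** Convexity of exp between l ln t and 0, with weight 1/l, gives t <= t^l / l + 1 - 1/l. *)
Lemma bernoulli_powR (R : realType) (l t : R) : 1 <= l -> 0 < t ->
  1 + l * (t - 1) <= t `^ l.
Proof.
move=> l1 t0; have l0 : 0 < l by lra.
have t01 : 0 <= l^-1 <= 1 by rewrite invr_ge0 ltW//= invf_le1.
have := @convex_expR R (Itv01 (proj1 (andP t01)) (proj2 (andP t01))) (l * ln t) 0.
rewrite !convRE /= /unstable.onem expR0 mulr0 addr0 mulrA mulVf ?gt_eqF// mul1r lnK//.
move=> h; rewrite /powR gt_eqF//.
have : l * t <= l * (l^-1 * expR (l * ln t) + (1 - l^-1)) by rewrite ler_pM2l// -[1 - _]mulr1.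
rewrite mulrDr mulrA divff ?gt_eqF// mul1r mulrBr divff ?gt_eqF//; lra.
Qed.

(** Bernoulli's inequality with exponent 1/m at the point (1 + y)^m. *)
Lemma powR_concave_le (R : realType) (m y : R) : 0 <= m <= 1 -> 0 <= y ->
  (1 + y) `^ m <= 1 + m * y.
Proof.
move=> /andP[m0 m1] y0; have [->|mn0] := eqVneq m 0; first by rewrite powRr0; lra.
have mp : 0 < m by rewrite lt_def mn0.
have y1 : 0 < 1 + y by lra.
have im1 : 1 <= m^-1 by rewrite -invr1 lef_pV2 ?posrE.
have := @bernoulli_powR R m^-1 ((1 + y) `^ m) im1 (powR_gt0 _ y1).
rewrite -powRrM divff// powRr1 ?(ltW y1)// => h.
have : m * (1 + m^-1 * ((1 + y) `^ m - 1)) <= m * (1 + y) by rewrite ler_pM2l.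
by rewrite mulrDr mulrA divff// mul1r; lra.
Qed.

(** Jensen for x^m: 1 + z is the average of 1/(1-t) and z/t with weights 1-t and t. Both values are
    bounded below by the tangent at w = 1 + z, and the weighted linear terms cancel. *)
Lemma powR_convex_split (R : realType) (m t z : R) : 1 <= m -> 0 < t < 1 -> 0 < z ->
  (1 + z) `^ m <= (1 - t) * (1 - t)^-1 `^ m + t * (z / t) `^ m.
Proof.
move=> m1 /andP[t0 t1] z0; set w := 1 + z; have w0 : 0 < w by rewrite /w; lra.
have tan (x : R) : 0 < x -> w `^ m * (1 + m * (x / w - 1)) <= x `^ m.
  move=> x0; rewrite -{2}(@divfK _ w _ x) ?gt_eqF//.
  rewrite powRM ?divr_ge0 ?(ltW x0) ?(ltW w0)// [(x / w) `^ m * _]mulrC ler_pM2l ?powR_gt0//.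
  by apply: bernoulli_powR => //; rewrite divr_gt0.
have h1 := tan (1 - t)^-1; have h2 := tan (z / t).
have p1 : 0 < (1 - t)^-1 by rewrite invr_gt0; lra.
have p2 : 0 < z / t by rewrite divr_gt0.
have {}h1 := h1 p1; have {}h2 := h2 p2.
have q1 : 0 < 1 - t by lra.
have e1 : (1 - t) * (w `^ m * (1 + m * ((1 - t)^-1 / w - 1))) <= (1 - t) * (1 - t)^-1 `^ m
  by rewrite ler_pM2l.
have e2 : t * (w `^ m * (1 + m * ((z / t) / w - 1))) <= t * (z / t) `^ m
  by rewrite ler_pM2l.
apply: le_trans (lerD e1 e2); apply/eq_le_porder.
rewrite /w; field; apply/and3P; split; rewrite ?gt_eqF//.
Qed.

(** K dominates the second derivative divided by l (l-1). With f the difference of the two sides and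
    [df] its derivative, f t <= f 1 follows from two mean value steps: one for f between 1 and t,
    and one for x^(l-1), which fixes the sign of [df] at the intermediate point. *)
Lemma powR_taylor2 (R : realType) (l t K : R) : 1 <= l -> 0 < t ->
  (forall x, Num.min 1 t <= x <= Num.max 1 t -> x `^ (l - 2) <= K) ->
  t `^ l <= 1 + l * (t - 1) + l * (l - 1) / 2 * (t - 1) ^+ 2 * K.
Proof.
move=> l1 t0 HK.
pose df (x : R) := l * x `^ (l - 1) - l - l * (l - 1) * K * (x - 1).
pose f (x : R) := x `^ l - (1 + l * (x - 1) + l * (l - 1) / 2 * (x - 1) ^+ 2 * K).
have fE : f = (fun x : R => x `^ l) \- (fun x => 1 + l * (x - 1) + l * (l - 1) / 2 * (x - 1) ^+ 2 * K) by [].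
have dfP (x : R) : 0 < x -> is_derive x 1 f (df x).
  move=> x0; rewrite fE.
  apply: is_derive_eq; first by apply: is_deriveB; exact: is_derive1_powR.
  by rewrite /df /GRing.scale /=; field.
have dpow (a x : R) : 0 < x -> is_derive x 1 (fun x : R => x `^ a) (a * x `^ (a - 1)).
  by move=> ?; exact: is_derive1_powR.
have cont (g dg : R -> R) (a b : R) : 0 < a -> (forall x : R, 0 < x -> is_derive x 1 g (dg x)) ->
    {within `[a, b], continuous g}.
  move=> a0 gd; apply: derivable_within_continuous => x; rewrite in_itv/= => /andP[ax _].
  by have [] := gd x (lt_le_trans a0 ax).
suff : f t <= f 1.
  by rewrite /f powR1 subrr mulr0 expr0n /= mulr0 mul0r; lra.
have mvt (g dg : R -> R) (a b : R) : 0 < a -> a < b -> (forall x : R, 0 < x -> is_derive x 1 g (dg x)) ->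
    exists2 x : R, a < x < b & g b - g a = dg x * (b - a).
  move=> a0 ab gd.
  have [|x] := @MVT R g dg a b ab _ (cont _ _ _ b a0 gd).
    by move=> x; rewrite in_itv/= => /andP[/(lt_trans a0) + _]; exact: gd.
  by rewrite in_itv/=; exists x.
have l0 : 0 < l by lra.
have [t1|t1|->//] := ltgtP t 1.
- have [x /andP[tx x1] fx] := mvt f df t 1 t0 t1 dfP.
  have x0 : 0 < x by lra.
  have [y /andP[xy y1]] := mvt (fun x => x `^ (l - 1)) _ x 1 x0 x1 (dpow (l - 1)).
  rewrite powR1 (_ : l - 1 - 1 = l - 2); last by lra.
  move=> py; have /HK yK : Num.min 1 t <= y <= Num.max 1 t.
    by rewrite minEle maxEle; case: ifPn; lra.
  have : (l - 1) * (1 - x) * y `^ (l - 2) <= (l - 1) * (1 - x) * K.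
    by rewrite ler_wpM2l// mulr_ge0; lra.
  have -> : (l - 1) * (1 - x) * y `^ (l - 2) = 1 - x `^ (l - 1) by rewrite py; ring.
  move=> h; have : 0 <= df x.
    have -> : df x = l * ((l - 1) * (1 - x) * K - (1 - x `^ (l - 1))) by rewrite /df; ring.
    by rewrite mulr_ge0; lra.
  move=> d0; have : 0 <= df x * (1 - t) by rewrite mulr_ge0; lra.
  by rewrite -fx; lra.
- have [x /andP[tx x1] fx] := mvt f df 1 t ltr01 t1 dfP.
  have x0 : 0 < x by lra.
  have [y /andP[xy y1]] := mvt (fun x => x `^ (l - 1)) _ 1 x ltr01 tx (dpow (l - 1)).
  rewrite powR1 (_ : l - 1 - 1 = l - 2); last by lra.
  move=> py; have /HK yK : Num.min 1 t <= y <= Num.max 1 t.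
    by rewrite minEle maxEle; case: ifPn; lra.
  have : (l - 1) * (x - 1) * y `^ (l - 2) <= (l - 1) * (x - 1) * K.
    by rewrite ler_wpM2l// mulr_ge0; lra.
  have -> : (l - 1) * (x - 1) * y `^ (l - 2) = x `^ (l - 1) - 1 by rewrite py; ring.
  move=> h; have : 0 <= - df x.
    have -> : - df x = l * ((l - 1) * (x - 1) * K - (x `^ (l - 1) - 1)) by rewrite /df; ring.
    by rewrite mulr_ge0; lra.
  move=> d0; have : 0 <= - df x * (t - 1) by rewrite mulr_ge0; lra.
  by rewrite mulNr -fx; lra.
Qed.

(** Y times the Taylor bound at X / Y, with K = (m / Y)^(l-2). Monotonicity of x^(l-2) reverses at l
    = 2, so m is a lower bound of X and Y below that value and an upper bound above it. The factor
    Y^(1-l) that remains has nonpositive exponent and is bounded through r. *)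
Lemma powR_div_taylor2 (R : realType) (l X Y r m : R) : 1 <= l -> 0 < r -> 0 < m ->
  r <= X -> r <= Y ->
  (l <= 2 /\ m <= X /\ m <= Y) \/ (2 <= l /\ X <= m /\ Y <= m) ->
  X `^ l * Y `^ (1 - l) <=
    Y + l * (X - Y) + l * (l - 1) / 2 * (X - Y) ^+ 2 * (m `^ (l - 2) * r `^ (1 - l)).
Proof.
move=> l1 r0 m0 rX rY H.
have X0 : 0 < X by lra.
have Y0 : 0 < Y by lra.
have Yp e : Y `^ (1 + e) = Y * Y `^ e.
  by rewrite powRD ?powRr1 ?(ltW Y0)// (gt_eqF Y0) implybT.
have mono (x : R) : Num.min 1 (X / Y) <= x <= Num.max 1 (X / Y) -> x `^ (l - 2) <= (m / Y) `^ (l - 2).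
  move=> /andP[x1 x2]; case: H => [[l2 [mX mY]]|[l2 [mX mY]]].
    have mx : m / Y <= x.
      apply: le_trans x1; rewrite le_min ler_pdivrMr// mul1r mY/=.
      by rewrite ler_pM2r// invr_gt0.
    have mY0 : 0 < m / Y by rewrite divr_gt0.
    rewrite -(opprB 2 l) 2!powRN lef_pV2 ?posrE ?powR_gt0//; last exact: lt_le_trans mx.
    by apply: ge0_ler_powR; rewrite ?nnegrE ?subr_ge0// ltW//; exact: lt_le_trans mx.
  have mx : x <= m / Y.
    apply: le_trans x2 _; rewrite ge_max ler_pdivlMr// mul1r mY/=.
    by rewrite ler_pM2r// invr_gt0.
  have x0 : 0 < x.
    by apply: lt_le_trans x1; rewrite lt_min ltr01 divr_gt0.
  apply: ge0_ler_powR => //; rewrite ?nnegrE ?subr_ge0//; first exact: ltW.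
  by rewrite divr_ge0// ltW.
have tXY : 0 < X / Y by rewrite divr_gt0.
have := powR_taylor2 _ _ _ _ l1 tXY mono.
rewrite -(ler_pM2l Y0).
have -> : Y * (X / Y) `^ l = X `^ l * Y `^ (1 - l).
  rewrite powRM ?invr_ge0 ?ltW// -powR_inv1 ?ltW// -powRrM mulN1r.
  rewrite Yp; ring.
move=> /le_trans; apply.
have Yi : (Y^-1) `^ (l - 2) = Y * Y `^ (1 - l).
  rewrite -powR_inv1 ?(ltW Y0)// -powRrM mulN1r opprB -Yp.
  by congr (_ `^ _); lra.
rewrite powRM ?invr_ge0 ?(ltW Y0) ?(ltW m0)// Yi.
have YlYr : Y `^ (1 - l) <= r `^ (1 - l).
  rewrite -(opprB l 1) 2!powRN lef_pV2 ?posrE ?powR_gt0//.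
  by apply: ge0_ler_powR; rewrite ?nnegrE ?subr_ge0 ?(ltW r0) ?(ltW Y0).
set u := m `^ (l - 2); set t := X / Y.
have -> : X = t * Y by rewrite divfK// gt_eqF.
have -> : Y * (1 + l * (t - 1) + l * (l - 1) / 2 * (t - 1) ^+ 2 * (u * (Y * Y `^ (1 - l)))) =
    Y + l * (t * Y - Y) + l * (l - 1) / 2 * (t * Y - Y) ^+ 2 * (u * Y `^ (1 - l)).
  move: (Y `^ _) u t (l - 1) 2^-1 => a b c e h.
  ring.
rewrite lerD2l ler_wpM2l//; last by rewrite ler_wpM2l ?powR_ge0.
by rewrite mulr_ge0 ?sqr_ge0// divr_ge0// mulr_ge0; lra.
Qed.

(** * Numerical bounds on the exponential *)

Lemma expR_sqr_le (R : realType) (x c c' : R) : expR x <= c -> c * c <= c' ->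
  expR (x + x) <= c'.
Proof.
move=> xc; apply: le_trans; rewrite expRD.
by rewrite ler_pM ?expR_ge0.
Qed.

Lemma expR_inv_le (R : realType) (x : R) : x < 1 -> expR x <= (1 - x)^-1.
Proof.
move=> x1; rewrite -[x in expR x]opprK expRN lef_pV2 ?posrE ?expR_gt0 ?subr_gt0//.
by have := expR_ge1Dx (- x).
Qed.

(** exp x <= 1/(1-x) at 3/1024, followed by eight squarings; each time the square is rounded up to a
    fraction with small terms. *)
Lemma expR_3_4_le (R : realType) : expR (3 / 4 : R) <= 17 / 8.
Proof.
have h0 : expR (3 / 1024 : R) <= 341 / 340.
  apply: le_trans (expR_inv_le _ _ _) _; first by lra.
  by rewrite -[leRHS]invrK lef_pV2 ?posrE; lra.
have {}h0 : expR (3 / 512 : R) <= 341 / 339.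
  rewrite (_ : 3 / 512 = 3 / 1024 + 3 / 1024); last by lra.
  by apply: expR_sqr_le h0 _; lra.
have {}h0 : expR (3 / 256 : R) <= 171 / 169.
  rewrite (_ : 3 / 256 = 3 / 512 + 3 / 512); last by lra.
  by apply: expR_sqr_le h0 _; lra.
have {}h0 : expR (3 / 128 : R) <= 43 / 42.
  rewrite (_ : 3 / 128 = 3 / 256 + 3 / 256); last by lra.
  by apply: expR_sqr_le h0 _; lra.
have {}h0 : expR (3 / 64 : R) <= 87 / 83.
  rewrite (_ : 3 / 64 = 3 / 128 + 3 / 128); last by lra.
  by apply: expR_sqr_le h0 _; lra.
have {}h0 : expR (3 / 32 : R) <= 256 / 233.
  rewrite (_ : 3 / 32 = 3 / 64 + 3 / 64); last by lra.
  by apply: expR_sqr_le h0 _; lra.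
have {}h0 : expR (3 / 16 : R) <= 303 / 251.
  rewrite (_ : 3 / 16 = 3 / 32 + 3 / 32); last by lra.
  by apply: expR_sqr_le h0 _; lra.
have {}h0 : expR (3 / 8 : R) <= 341 / 234.
  rewrite (_ : 3 / 8 = 3 / 16 + 3 / 16); last by lra.
  by apply: expR_sqr_le h0 _; lra.
have {}h0 : expR (3 / 4 : R) <= 773 / 364.
  rewrite (_ : 3 / 4 = 3 / 8 + 3 / 8); last by lra.
  by apply: expR_sqr_le h0 _; lra.
lra.
Qed.

Lemma expR_3_5_le (R : realType) : expR (3 / 5 : R) <= 183 / 100.
Proof.
have h0 : expR (3 / 320 : R) <= 320 / 317.
  apply: le_trans (expR_inv_le _ _ _) _; first by lra.
  by rewrite -[leRHS]invrK lef_pV2 ?posrE; lra.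
have {}h0 : expR (3 / 160 : R) <= 375 / 368.
  rewrite (_ : 3 / 160 = 3 / 320 + 3 / 320); last by lra.
  by apply: expR_sqr_le h0 _; lra.
have {}h0 : expR (3 / 80 : R) <= 27 / 26.
  rewrite (_ : 3 / 80 = 3 / 160 + 3 / 160); last by lra.
  by apply: expR_sqr_le h0 _; lra.
have {}h0 : expR (3 / 40 : R) <= 55 / 51.
  rewrite (_ : 3 / 40 = 3 / 80 + 3 / 80); last by lra.
  by apply: expR_sqr_le h0 _; lra.
have {}h0 : expR (3 / 20 : R) <= 478 / 411.
  rewrite (_ : 3 / 20 = 3 / 40 + 3 / 40); last by lra.
  by apply: expR_sqr_le h0 _; lra.
have {}h0 : expR (3 / 10 : R) <= 491 / 363.
  rewrite (_ : 3 / 10 = 3 / 20 + 3 / 20); last by lra.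
  by apply: expR_sqr_le h0 _; lra.
have {}h0 : expR (3 / 5 : R) <= 730 / 399.
  rewrite (_ : 3 / 5 = 3 / 10 + 3 / 10); last by lra.
  by apply: expR_sqr_le h0 _; lra.
lra.
Qed.

(** The left side bounds the mean of (A - B)^2 in one step. With y = exp(tau/2) it is 2 y (y - 1);
    the chord of exp on [0, 3/4] gives y - 1 <= 3/4 tau, and 2 * 17/8 * 3/4 = 51/16. *)
Lemma expR_gap_le (R : realType) (tau : R) : 0 < tau <= 3 / 2 ->
  2 * (expR tau - expR (tau / 2)) <= 51 / 16 * tau.
Proof.
move=> /andP[t0 t1]; set y := expR (tau / 2).
have -> : expR tau = y * y by rewrite -expRD; congr expR; lra.
have hy : y <= 1 + (expR (3 / 4) - 1) / (3 / 4) * (tau / 2) by apply: expR_chord; lra.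
have h34 := expR_3_4_le R.
have y2 : y <= 17 / 8 by apply: le_trans h34; rewrite ler_expR; lra.
have y0 : 0 < y := expR_gt0 _.
have y1 : y - 1 <= 3 / 4 * tau.
  have : (expR (3 / 4) - 1) / (3 / 4) * (tau / 2) <= (17 / 8 - 1) / (3 / 4) * (tau / 2).
    by rewrite ler_wpM2r//; lra.
  lra.
have : y * (y - 1) <= 17 / 8 * (3 / 4 * tau).
  apply: (@le_trans _ _ (y * (3 / 4 * tau))); first by rewrite ler_pM2l.
  by rewrite ler_pM2r//; lra.
lra.
Qed.

(** The chord of exp on [0, 9/4], with exp(9/4) <= (17/8)^3; the constant 96/25 is almost attained
    at tau = 3/2. *)
Lemma expR_3_2_le (R : realType) (tau : R) : 0 < tau <= 3 / 2 ->
  expR (3 / 2 * tau) <= 96 / 25 * (1 + tau).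
Proof.
move=> /andP[t0 t1].
have h34 := expR_3_4_le R.
have h94 : expR (9 / 4 : R) <= 4913 / 512.
  rewrite (_ : 9 / 4 = 3 / 4 + 3 / 4 + 3 / 4); last by lra.
  rewrite 2!expRD (_ : 4913 / 512 = 17 / 8 * (17 / 8) * (17 / 8)); last by lra.
  by rewrite !ler_pM ?mulr_ge0 ?expR_ge0.
have : expR (3 / 2 * tau) <= 1 + (expR (9 / 4) - 1) / (9 / 4) * (3 / 2 * tau).
  by apply: expR_chord; lra.
have : (expR (9 / 4) - 1) / (9 / 4) * (3 / 2 * tau) <= (4913 / 512 - 1) / (9 / 4) * (3 / 2 * tau).
  by rewrite ler_wpM2r//; lra.
lra.
Qed.

(** * Second-order bounds for powers of mixtures *)

Lemma mixture_powR_le2 (R : realType) (p l A B : R) :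
  0 < p -> p < 1 -> 1 <= l -> 0 < A -> 0 < B ->
  let X := 1 - p + p * A in let Y := 1 - p + p * B in
  l <= 2 ->
  X `^ l * Y `^ (1 - l) <=
    Y + l * (X - Y) + l * (l - 1) / 2 * (p ^+ 2 / (1 - p)) * (A - B) ^+ 2.
Proof.
move=> p0 p1 l1 A0 B0 /= l2; set X := 1 - p + p * A; set Y := 1 - p + p * B.
have XE : X = 1 - p + p * A by [].
have YE : Y = 1 - p + p * B by [].
clearbody X Y; have r0 : 0 < 1 - p by lra.
have pA : 0 < p * A by rewrite mulr_gt0.
have pB : 0 < p * B by rewrite mulr_gt0.
have rX : 1 - p <= X by lra.
have rY : 1 - p <= Y by lra.
have := powR_div_taylor2 _ _ _ _ _ _ l1 r0 r0 rX rY (or_introl (conj l2 (conj rX rY))).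
move=> /le_trans; apply; rewrite lerD2l.
have -> : (1 - p) `^ (l - 2) * (1 - p) `^ (1 - l) = (1 - p)^-1.
  rewrite -powRD; last by rewrite (gt_eqF r0) implybT.
  by rewrite (_ : l - 2 + (1 - l) = -1) ?powR_inv1 ?(ltW r0)//; lra.
by apply: eq_le_porder; rewrite XE YE; move: (1 - p)^-1 => r; ring.
Qed.

(** As A, B > 0, both mixtures are at least r = 1 - p. For l <= 2 this value also serves as m; here
    m is the mixture at max(A, B), written (1-p)(1 + p/(1-p) max(A, B)). In both cases the powers of
    1 - p combine to 1/(1-p). *)
Lemma mixture_powR_ge2 (R : realType) (p l A B : R) :
  0 < p -> p < 1 -> 1 <= l -> 0 < A -> 0 < B ->
  let X := 1 - p + p * A in let Y := 1 - p + p * B in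
  2 <= l ->
  X `^ l * Y `^ (1 - l) <=
    Y + l * (X - Y) + l * (l - 1) / 2 * (p ^+ 2 / (1 - p)) *
      ((A - B) ^+ 2 * (1 + p / (1 - p) * Num.max A B) `^ (l - 2)).
Proof.
move=> p0 p1 l1 A0 B0 /= l2; set X := 1 - p + p * A; set Y := 1 - p + p * B.
have XE : X = 1 - p + p * A by [].
have YE : Y = 1 - p + p * B by [].
clearbody X Y; have r0 : 0 < 1 - p by lra.
have pA : 0 < p * A by rewrite mulr_gt0.
have pB : 0 < p * B by rewrite mulr_gt0.
have rX : 1 - p <= X by lra.
have rY : 1 - p <= Y by lra.
set M := Num.max A B.
have AM : A <= M by rewrite le_max lexx.
have BM : B <= M by rewrite le_max lexx orbT.
have XM : X <= 1 - p + p * M by rewrite XE lerD2l ler_pM2l.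
have YM : Y <= 1 - p + p * M by rewrite YE lerD2l ler_pM2l.
have m0 : 0 < 1 - p + p * M by rewrite (lt_le_trans _ XM)// (lt_le_trans r0).
have := powR_div_taylor2 _ _ _ _ _ _ l1 r0 m0 rX rY (or_intror (conj l2 (conj XM YM))).
move=> /le_trans; apply; rewrite lerD2l.
have -> : 1 - p + p * M = (1 - p) * (1 + p / (1 - p) * M).
  by field; rewrite gt_eqF.
have M0 : 0 <= 1 + p / (1 - p) * M.
  by rewrite addr_ge0// mulr_ge0 ?divr_ge0 ?(ltW p0) ?(ltW r0)//; lra.
rewrite powRM ?(ltW r0)//.
have e : (1 - p) `^ (l - 2) * (1 - p) `^ (1 - l) = (1 - p)^-1.
  rewrite -powRD; last by rewrite (gt_eqF r0) implybT.
  by rewrite (_ : l - 2 + (1 - l) = -1) ?powR_inv1 ?(ltW r0)//; lra.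
apply: eq_le_porder; rewrite [_ * (1 - p) `^ (1 - l)]mulrAC e XE YE.
by move: (1 - p)^-1 (_ `^ _) => r q; ring.
Qed.

Lemma sqr_sub_max_le (R : realType) (h A B : R) : 0 < A -> 0 < B ->
  (A - B) ^+ 2 * Num.max A B `^ h <= A `^ (h + 2) + B `^ (h + 2).
Proof.
move=> A0 B0; have E (x : R) : 0 < x -> x ^+ 2 * x `^ h = x `^ (h + 2).
  by move=> x0; rewrite powRD ?(gt_eqF x0) ?implybT// -(powR_mulrn 2) ?(ltW x0)// mulrC.
have [AB|BA] := leP A B.
  apply: (@le_trans _ _ (B ^+ 2 * B `^ h)).
    by rewrite ler_wpM2r ?powR_ge0//; nra.
  by rewrite E// lerDr powR_ge0.
apply: (@le_trans _ _ (A ^+ 2 * A `^ h)).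
  by rewrite ler_wpM2r ?powR_ge0//; nra.
by rewrite E// lerDl powR_ge0.
Qed.

(* The remainder of the second-order Taylor estimate is bounded by a polynomial in
   A, B whose Gaussian moments are explicit; k1, k2, h depend on whether l <= 2,
   2 < l <= 3 (where x^(l-2) is concave) or l > 3 (where it is split by convexity
   with weight c / (l-2)). *)
Lemma mixture_moment_bound (R : realType) (tau p l : R) :
  0 < tau <= 3 / 2 -> 0 < p <= 1 / 3 -> 1 < l ->
  p * l * expR (3 / 2 * tau * (l - 1)) <= tau / (1 + tau) ->
  exists k1 k2 h : R, [/\ 0 <= k1, 0 <= k2, 1 <= h,
    (forall A B : R, 0 < A -> 0 < B ->
      (1 - p + p * A) `^ l * (1 - p + p * B) `^ (1 - l) <=
        1 - p + p * B + l * (p * (A - B)) +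
        l * (l - 1) / 2 * (p ^+ 2 / (1 - p)) *
          (k1 * (A - B) ^+ 2 + k2 * (A `^ h + B `^ h))) &
    k1 * (2 * (expR tau - expR (tau / 2))) + 2 * k2 * expR (h * (h - 1) / 2 * tau)
      <= 7 * tau * (1 - p)].
Proof.
move=> tauP /andP[p0 p3] l1; set c := tau / (1 + tau) => hc.
have /andP[t0 t1] := tauP.
have c0 : 0 < c by rewrite divr_gt0//; lra.
have p1 : p < 1 by lra.
have r0 : 0 < 1 - p by lra.
have gap := expR_gap_le _ _ tauP.
have coef0 : 0 <= l * (l - 1) / 2 * (p ^+ 2 / (1 - p)).
  by rewrite mulr_ge0 ?divr_ge0 ?mulr_ge0 ?sqr_ge0//; lra.
have cE : c * (1 + tau) = tau by rewrite divfK// gt_eqF//; lra.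
have [l2|l2] := leP l 2.
  (* For l <= 2 the remainder is a pure square: 51/16 tau is below 7 * 2/3 * tau. *)
  exists 1, 0, 1; split=> // [A B A0 B0|].
    apply: le_trans (mixture_powR_le2 _ _ _ _ _ p0 p1 (ltW l1) A0 B0 l2) _.
    rewrite (_ : 1 - p + p * A - _ = p * (A - B)); last by ring.
    by rewrite mul0r addr0 mul1r.
  by rewrite mulr0 mul0r addr0 mul1r; nra.
have q0 : 0 < p / (1 - p) by rewrite divr_gt0.
set q := p / (1 - p).
have qE : q * (1 - p) = p by rewrite divfK// gt_eqF.
have [l3|l3] := leP l 3.
  have e1 := expR_ge1Dx (3 / 2 * tau).
  set E := expR (3 / 2 * tau) in e1.
  have EE0 : E = expR (3 / 2 * tau) by [].
  set m := l - 2; have mE : m = l - 2 by [].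
  clearbody m.
  have E0 : 0 < E := expR_gt0 _.
  have F1 : 1 <= expR (3 / 2 * tau * m) by rewrite -[leLHS]expR0 ler_expR mulr_ge0//; move: t0 l2 mE; clear; lra.
  have EE : expR (3 / 2 * tau * (l - 1)) = E * expR (3 / 2 * tau * m).
    by rewrite -expRD; congr expR; rewrite mE; ring.
  have pE : p * l * E <= c.
    apply: le_trans hc; rewrite EE mulrA ler_pMr// mulr_gt0// mulr_gt0//; move: l1; clear; lra.
  have p11 : p <= 11 / 100.
    have h1 : p * 2 * (1 + 3 / 2 * tau) <= c.
      by apply: le_trans pE; apply: ler_pM => //; [by rewrite !mulr_ge0 ?(ltW p0)|by move: t0; clear; lra|by rewrite ler_pM2l// ltW].
    have h2 : p * 2 * (1 + 3 / 2 * tau) * (1 + tau) <= tau.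
      by rewrite -[leRHS]cE ler_pM2r//; move: t0; clear; lra.
    have [//|hp] := leP p (11 / 100).
    have h3 : 11 / 100 * (2 * (1 + 3 / 2 * tau) * (1 + tau)) < p * (2 * (1 + 3 / 2 * tau) * (1 + tau)).
      by rewrite ltr_pM2r// !mulr_gt0//; move: t0; clear; lra.
    (* The hypothesis with l > 2 gives 2 p (1 + 3/2 tau)(1 + tau) <= tau. At p = 11/100 the
       difference of the two sides is a quadratic in tau with vertex 15/22 and positive minimum. *)
    have := sqr_ge0 (tau - 15 / 22); rewrite expr2; move: h2 h3 t0 t1; clear; lra.
  have qp : q <= p * (100 / 89).
    by rewrite /q ler_pdivrMr//; nra.
  (* Concavity gives (1 + q max)^m <= 1 + m q max, whose second term turns the square into third
     powers. *)
  exists 1, (m * q), 3; split=> // [||A B A0 B0|].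
  - by rewrite mulr_ge0 ?(ltW q0)// mE; move: l2; clear; lra.
  - by clear; lra.
  - apply: le_trans (mixture_powR_ge2 _ _ _ _ _ p0 p1 (ltW l1) A0 B0 (ltW l2)) _.
    rewrite (_ : 1 - p + p * A - _ = p * (A - B)); last by ring.
    rewrite lerD2l ler_wpM2l// mul1r.
    have M0 : 0 < Num.max A B by rewrite lt_max A0.
    have hm : (1 + q * Num.max A B) `^ (l - 2) <= 1 + m * (q * Num.max A B).
      rewrite -mE; apply: powR_concave_le; first by move: l2 l3 mE; clear; lra.
      by rewrite mulr_ge0// ?(ltW M0) ?(ltW q0).
    have mx := sqr_sub_max_le R 1 A B A0 B0.
    rewrite powRr1 ?(ltW M0)// (_ : 1 + 2 = 3) in mx; last by clear; lra.
    have : (A - B) ^+ 2 * (1 + q * Num.max A B) `^ (l - 2) <= (A - B) ^+ 2 * (1 + m * (q * Num.max A B)).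
      by rewrite ler_wpM2l// sqr_ge0.
    have : m * q * ((A - B) ^+ 2 * Num.max A B) <= m * q * (A `^ 3 + B `^ 3).
      by rewrite ler_wpM2l// mulr_ge0 ?(ltW q0)// mE; lra.
    lra.
  - have E32 := expR_3_2_le _ _ tauP; rewrite -/E in E32.
    (* The third moment is E * E: one factor E is absorbed by the hypothesis on p l E, the other by
       the denominator of c. *)
    have -> : expR (3 * (3 - 1) / 2 * tau) = E * E by rewrite -expRD; congr expR; clear; lra.
    have mq : m * q * E <= 100 / 267 * c.
      have l0 : 0 < l by move: l1; clear; lra.
      have ml : m <= l / 3 by rewrite mE; move: l3; clear; lra.
      have m0 : 0 <= m by rewrite mE; move: l2; clear; lra.
      apply: (@le_trans _ _ (l / 3 * (p * (100 / 89)) * E)).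
        by rewrite ler_wpM2r ?(ltW E0)// ler_pM ?(ltW q0).
      by move: pE; clear; lra.
    have cE2 : c * E <= 96 / 25 * tau.
      apply: (@le_trans _ _ (c * (96 / 25 * (1 + tau)))); first by rewrite ler_pM2l.
      by rewrite mulrCA cE.
    have : m * q * E * E <= 100 / 267 * c * E by rewrite ler_wpM2r ?(ltW E0).
    have : (1 - p) * tau >= 89 / 100 * tau by rewrite ler_pM2r//; move: p11; clear; lra.
    move: gap cE2 t0 t1; clear; lra.
set m := l - 2; have mE : m = l - 2 by [].
clearbody m.
set F := expR (3 / 2 * tau * (l - 1)) in hc.
have FE : F = expR (3 / 2 * tau * (l - 1)) by [].
have F0 : 0 < F := expR_gt0 _.
have F3 : 1 + 3 * tau <= F.
  by apply: le_trans (expR_ge1Dx _) _; rewrite ler_expR; nra.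
clearbody F.
have c6 : c <= 3 / 5 by rewrite /c ler_pdivrMr; move: t0 t1; clear; lra.
have pl : p * l <= 1.
  have : p * l * 1 <= p * l * F by rewrite ler_pM2l ?mulr_gt0//; [by move: F3 t0; clear; lra|by move: l1; clear; lra].
  move: hc c6; clear; lra.
have p20 : p <= 1 / 20.
  have h1 : p * 3 * (1 + 3 * tau) <= c.
    by apply: le_trans hc; apply: ler_pM => //; [by rewrite !mulr_ge0 ?(ltW p0)|by move: t0; clear; lra|by rewrite ler_pM2l// ltW].
  have h2 : p * 3 * (1 + 3 * tau) * (1 + tau) <= tau.
    by rewrite -[leRHS]cE ler_pM2r//; move: t0; clear; lra.
  have [//|hp] := leP p (1 / 20).
  have h3 : 1 / 20 * (3 * (1 + 3 * tau) * (1 + tau)) < p * (3 * (1 + 3 * tau) * (1 + tau)).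
    by rewrite ltr_pM2r// !mulr_gt0//; move: t0; clear; lra.
  have := sqr_ge0 (tau - 1 / 2); rewrite expr2; move: h2 h3 t0 t1; clear; lra.
have q00 : 0 < q := q0.
have ql : q * (l - 1) <= p * l.
  rewrite /q mulrAC ler_pdivrMr//.
  have : p * (p * l) <= p * 1 by rewrite ler_pM2l.
  clear; lra.
have m1 : 1 <= m by move: l3 mE; clear; lra.
have m0 : 0 < m by move: m1; clear; lra.
(* The splitting weight is chosen so that th * m = c: the first part of the split then costs at most
   exp c, uniformly in l, while the second keeps the small base q / th. *)
set th := c / m.
have th0 : 0 < th by rewrite divr_gt0.
have thm : th * m = c by rewrite divfK// gt_eqF.
have thc : th <= c by rewrite ler_pdivrMr//; nra.
have th1 : th < 1 by move: thc c6; clear; lra.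
(* Since q m <= q (l-1) <= p l, the hypothesis bounds q / th by 1 / F. *)
have qth : q / th <= expR (- (3 / 2 * tau * (l - 1))).
  rewrite expRN -FE ler_pdivrMr// mulrC ler_pdivlMr//.
  rewrite -(ler_pM2r m0) thm; apply: le_trans hc.
  have : q * m * F <= q * (l - 1) * F by rewrite ler_pM2r// ler_pM2l//; move: mE; clear; lra.
  have : q * (l - 1) * F <= p * l * F by rewrite ler_pM2r.
  clear; lra.
have qth0 : 0 < q / th by rewrite divr_gt0.
exists (expR c), (th * (q / th) `^ m), l; split=> [|||A B A0 B0|].
- exact: expR_ge0.
- by rewrite mulr_ge0 ?(ltW th0) ?powR_ge0.
- exact: ltW.
- apply: le_trans (mixture_powR_ge2 _ _ _ _ _ p0 p1 (ltW l1) A0 B0 (ltW l2)) _.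
  rewrite (_ : 1 - p + p * A - _ = p * (A - B)); last by ring.
  rewrite lerD2l ler_wpM2l//.
  have M0 : 0 < Num.max A B by rewrite lt_max A0.
  have mx := sqr_sub_max_le R m A B A0 B0.
  rewrite (_ : m + 2 = l) in mx; last by move: mE; clear; lra.
  have qM0 : 0 < q * Num.max A B by rewrite mulr_gt0.
  have hs := powR_convex_split _ _ _ _ m1 (introT andP (conj th0 th1)) qM0.
  have s0 : 0 < 1 - th by move: th1; clear; lra.
  have e1 : (1 - th) * (1 - th)^-1 `^ m <= expR c.
    rewrite -(mulr_powRB1 _ m0) ?invr_ge0 ?(ltW s0)//.
    rewrite mulrA divff ?gt_eqF// mul1r.
    apply: (@le_trans _ _ (expR (th / (1 - th)) `^ (m - 1))).
      apply: ge0_ler_powR; rewrite ?nnegrE ?invr_ge0 ?expR_ge0 ?(ltW s0)//; first by move: m1; clear; lra.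
      apply: le_trans (expR_ge1Dx _).
      by apply: eq_le_porder; field; rewrite gt_eqF.
    rewrite -expRM ler_expR mulrAC ler_pdivrMr//.
    have : c * th <= 1 * th by rewrite ler_pM2r//; move: c6; clear; lra.
    move: thm; clear; lra.
  have e2 : (q * Num.max A B / th) `^ m = (q / th) `^ m * Num.max A B `^ m.
    rewrite (_ : q * Num.max A B / th = q / th * Num.max A B); last by rewrite mulrAC.
    by apply: powRM; exact: ltW.
  rewrite e2 in hs.
  set k := (q / th) `^ m in hs *; have k0 : 0 <= k by exact: powR_ge0.
  rewrite -mE.
  apply: (@le_trans _ _ ((A - B) ^+ 2 * (expR c + th * (k * Num.max A B `^ m)))).
    by rewrite ler_wpM2l ?sqr_ge0// (le_trans hs)// lerD2r.
  rewrite mulrDr [leRHS]addrC (mulrC (expR c)) [leRHS]addrC lerD2l.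
  rewrite (_ : _ * (th * _) = th * k * ((A - B) ^+ 2 * Num.max A B `^ m)); last by ring.
  by rewrite ler_wpM2l// mulr_ge0// ltW.
- have k2 : th * (q / th) `^ m * expR (l * (l - 1) / 2 * tau) <= c.
    rewrite -mulrA; apply: le_trans thc; rewrite -[leRHS]mulr1 ler_pM2l//.
    apply: (@le_trans _ _ (expR (- (3 / 2 * tau * (l - 1))) `^ m * expR (l * (l - 1) / 2 * tau))).
      rewrite ler_pM2r ?expR_gt0//; apply: ge0_ler_powR => //; rewrite ?nnegrE ?expR_ge0 ?(ltW m0) ?(ltW qth0)//.
    rewrite -expRM -expRD -[leRHS]expR0 ler_expR mE.
    (* This is where the factor 3/2 of the hypothesis is needed: the decay exp(-3/2 tau (l-1)(l-2))
       of (q / th)^m beats the moment exp(l (l-1)/2 tau) exactly from l = 3 on. *)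
    rewrite (_ : _ + _ = - ((l - 1) * (l - 3) * tau)); last by field.
    by rewrite oppr_le0 !mulr_ge0//; move: t0 l3 l1; clear; lra.
  have h35 := expR_3_5_le R.
  have ec : expR c <= 1 + 83 / 60 * c.
    have := @expR_chord R (3 / 5) c; rewrite ltW//= c6 => /(_ _ isT) h.
    have {}h : expR c <= 1 + (expR (3 / 5) - 1) / (3 / 5) * c by apply: h; clear; lra.
    have : (expR (3 / 5) - 1) / (3 / 5) * c <= (183 / 100 - 1) / (3 / 5) * c.
      by rewrite ler_wpM2r ?(ltW c0)//; move: h35; clear; lra.
    move: h; clear; lra.
  have eg : expR c * (2 * (expR tau - expR (tau / 2))) <= (1 + 83 / 60 * c) * (51 / 16 * tau).
    apply: ler_pM => //; rewrite ?expR_ge0//.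
    by rewrite mulr_ge0// subr_ge0 ler_expR; move: t0; clear; lra.
  have ct : c * tau <= 3 / 5 * tau by rewrite ler_pM2r.
  (* With c = tau - c tau and c <= 3/5 the total is at most 6.634 tau, against 7 * 19/20 * tau =
     6.65 tau: of the three cases this one leaves the least room for the constant 7. *)
  have : (1 - p) * tau >= 19 / 20 * tau by rewrite ler_pM2r//; move: p20; clear; lra.
  move: eg ct k2 cE t0; clear; lra.
Qed.

(** For few data points 1/(1-p) is too large for the Taylor bound, but then the hypothesis is very
    strong: l F <= 9/5 makes y = l (l-1) tau / 2 small enough for exp y <= 7/3, and exp y - 1 <= y
    exp y <= 7 p y because p >= 1/3. *)
Lemma expR_sub1_le_sampled (R : realType) (tau p l : R) :
  0 < tau <= 3 / 2 -> 1 / 3 <= p -> 1 < l ->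
  p * l * expR (3 / 2 * tau * (l - 1)) <= tau / (1 + tau) ->
  p * (expR (l * (l - 1) / 2 * tau) - 1) <= 7 / 2 * p ^+ 2 * (l * (l - 1)) * tau.
Proof.
move=> /andP[t0 t1] p3 l1 hc.
set F := expR _ in hc.
have F1 : 1 + 3 / 2 * tau * (l - 1) <= F := expR_ge1Dx _.
have u0 : 0 < tau * (l - 1) by rewrite mulr_gt0//; lra.
have c6 : tau / (1 + tau) <= 3 / 5 by rewrite ler_pdivrMr; lra.
have lF : 1 / 3 * (l * F) <= 3 / 5.
  apply: le_trans c6; apply: le_trans hc; rewrite -(mulrA p l).
  by apply: ler_wpM2r => //; rewrite mulr_ge0// /F ?expR_ge0//; lra.
have l0 : 0 < l by lra.
have lF1 : l * (1 + 3 / 2 * tau * (l - 1)) <= 9 / 5.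
  have : l * (1 + 3 / 2 * tau * (l - 1)) <= l * F by rewrite ler_pM2l.
  lra.
have l18 : l <= 9 / 5.
  have : 0 < l * (tau * (l - 1)) by rewrite mulr_gt0.
  lra.
set y := l * (l - 1) / 2 * tau.
have yE : y = l * (tau * (l - 1)) / 2 by rewrite /y; field.
have y0 : 0 < y by rewrite yE divr_gt0// mulr_gt0.
have yu : y <= 12 / 25.
  have : l * (tau * (l - 1)) <= 9 / 5 * (tau * (l - 1)) by rewrite ler_pM2r.
  have : 1 * (tau * (l - 1)) <= l * (tau * (l - 1)) by rewrite ler_pM2r//; lra.
  rewrite yE; lra.
have ey : expR y <= 7 / 3.
  apply: le_trans (expR_inv_le _ _ _) _; first by lra.
  by rewrite -[leRHS]invrK lef_pV2 ?posrE; lra.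
have e1 : expR y - 1 <= y * expR y.
  have : expR y * (1 - y) <= expR y * expR (- y).
    by rewrite ler_pM2l ?expR_gt0//; exact: expR_ge1Dx.
  rewrite expRxMexpNx_1; lra.
have e2 : y * expR y <= y * (7 / 3) by rewrite ler_pM2l.
have p0 : 0 < p by lra.
have -> : 7 / 2 * p ^+ 2 * (l * (l - 1)) * tau = p * (7 * p * y) by rewrite /y; field.
rewrite ler_pM2l//.
have : 1 / 3 * y <= p * y by rewrite ler_pM2r.
lra.
Qed.

(** * Euclidean space and its Borel sets *)

Section vdot.
Context {R : realType} {dim : nat}.
Implicit Types u v w : 'rV[R]_dim.

Lemma vdotC u v : vdot u v = vdot v u.
Proof. by apply: eq_bigr => i _; rewrite mulrC. Qed.

Lemma vdotDl u v w : vdot (u + v) w = vdot u w + vdot v w.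
Proof. by rewrite -big_split; apply: eq_bigr => i _; rewrite mxE mulrDl. Qed.

Lemma vdotZl c u v : vdot (c *: u) v = c * vdot u v.
Proof. by rewrite mulr_sumr; apply: eq_bigr => i _; rewrite mxE mulrA. Qed.

Lemma vdotNl u v : vdot (- u) v = - vdot u v.
Proof. by rewrite -scaleN1r vdotZl mulN1r. Qed.

Lemma vdotBl u v w : vdot (u - v) w = vdot u w - vdot v w.
Proof. by rewrite vdotDl vdotNl. Qed.

Lemma vdotDr u v w : vdot w (u + v) = vdot w u + vdot w v.
Proof. by rewrite vdotC vdotDl !(vdotC w). Qed.

Lemma vdotZr c u v : vdot u (c *: v) = c * vdot u v.
Proof. by rewrite vdotC vdotZl vdotC. Qed.

Lemma vdotNr u v : vdot u (- v) = - vdot u v.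
Proof. by rewrite vdotC vdotNl vdotC. Qed.

Lemma vdotBr u v w : vdot w (u - v) = vdot w u - vdot w v.
Proof. by rewrite vdotDr vdotNr. Qed.

Lemma vdot_addZ u v t : vdot (u + t *: v) (u + t *: v) =
  vdot u u + 2 * t * vdot u v + t ^+ 2 * vdot v v.
Proof. by rewrite !(vdotDl, vdotDr, vdotZl, vdotZr) (vdotC v u); ring. Qed.

Lemma vdot_ge0 u : 0 <= vdot u u.
Proof. by apply: sumr_ge0 => i _; rewrite -expr2 sqr_ge0. Qed.

Lemma sqr_vnorm u : vnorm u ^+ 2 = vdot u u.
Proof. by rewrite sqr_sqrtr// vdot_ge0. Qed.

Lemma ler_vnorm u v : vnorm u <= vnorm v -> vdot u u <= vdot v v.
Proof. by rewrite -!sqr_vnorm => h; rewrite ler_sqr ?nnegrE ?sqrtr_ge0. Qed.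

Lemma vnorm_le_vdot u (G : R) : vnorm u <= G -> vdot u u <= G ^+ 2.
Proof.
move=> h; have G0 : 0 <= G := le_trans (sqrtr_ge0 _) h.
by rewrite -sqr_vnorm ler_sqr ?nnegrE ?sqrtr_ge0.
Qed.

Lemma vdot_sub_le (u v : 'rV[R]_dim) (G : R) : vnorm u <= G -> vnorm v <= G ->
  vdot (u - v) (u - v) <= 4 * G ^+ 2.
Proof.
move=> /vnorm_le_vdot hu /vnorm_le_vdot hv.
have := vdot_ge0 (u + v); rewrite !(vdotBl, vdotBr, vdotDl, vdotDr) (vdotC v u); lra.
Qed.

Lemma sqr_coord_le u i : u ord0 i ^+ 2 <= vdot u u.
Proof.
rewrite /vdot (bigD1 i)//= -expr2 lerDl; apply: sumr_ge0 => j _.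
by rewrite -expr2 sqr_ge0.
Qed.

Lemma vdot_le_sqr_sum u : vdot u u <= (\sum_i `|u ord0 i|) ^+ 2.
Proof.
rewrite expr2 mulr_suml; apply: ler_sum => i _.
rewrite (bigD1 i)//= mulrDr -normrM -[leLHS]addr0 lerD ?ler_norm//.
by rewrite mulr_ge0// sumr_ge0.
Qed.

End vdot.

(** * Projection onto a convex set *)

Section projection.
Context {R : realType} {dim : nat}.
Variables (W : set 'rV[R]_dim) (proj : 'rV[R]_dim -> 'rV[R]_dim).
Hypothesis convW : convex_subset W.
Hypothesis projP : forall x, W (proj x) /\ forall w, W w -> vnorm (proj x - x) <= vnorm (w - x).

(** The variational inequality of the projection: minimality along the segment from [proj x] to w
    gives 0 <= 2 b + t c for every t in ]0, 1]. *)
Lemma proj_obtuse x w : W w -> 0 <= vdot (proj x - x) (w - proj x).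
Proof.
move=> Ww; have [Wp minp] := projP x.
set a := proj x - x; set e := w - proj x; set b := vdot a e.
set c := vdot e e; have c0 : 0 <= c := vdot_ge0 _.
have key (t : R) : 0 < t <= 1 -> 0 <= 2 * b + t * c.
  move=> /andP[t0 t1].
  have t01 : 0 <= t <= 1 by rewrite ltW.
  have := ler_vnorm _ _ (minp _ (convW _ _ _ Ww Wp t01)).
  have -> : t *: w + (1 - t) *: proj x - x = a + t *: e.
    by rewrite /a /e scalerBr scalerBl scale1r; apply/rowP => i; rewrite !mxE; ring.
  rewrite vdot_addZ -/a -/b -/c => h.
  have : 0 <= t * (2 * b + t * c) by lra.
  by rewrite pmulr_rge0.
have [//|b0] := leP 0 b.
have cb : 0 < c - b by lra.
(* If b < 0, this t is admissible and 2 b + t c = b (c - 2b)/(c - b) is negative. *)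
have /key : 0 < - b / (c - b) <= 1.
  by rewrite divr_gt0 ?ler_pdivrMr//=; lra.
move=> h; have : 0 <= (2 * b + - b / (c - b) * c) * (c - b) by rewrite mulr_ge0// ltW.
rewrite (_ : _ * (c - b) = b * (c - 2 * b)); last by field; rewrite gt_eqF.
by rewrite leNgt nmulr_rlt0//; lra.
Qed.

(** The sum of the two obtuse-angle inequalities, at x against [proj y] and at y against [proj x],
    together with the nonnegative square of (x - y) - (proj x - proj y). *)
Lemma proj_nonexpansive x y :
  vdot (proj x - proj y) (proj x - proj y) <= vdot (x - y) (x - y).
Proof.
have h1 := proj_obtuse x _ (projP y).1.
have h2 := proj_obtuse y _ (projP x).1.
have h3 := vdot_ge0 (x - y - (proj x - proj y)).
set P := proj x in h1 h2 h3 *; set Q := proj y in h1 h2 h3 *.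
move: h1 h2 h3; rewrite !(vdotBl, vdotBr).
rewrite (vdotC Q P) (vdotC y x) (vdotC P x) (vdotC P y) (vdotC Q x) (vdotC Q y).
lra.
Qed.

Lemma proj_coord_lipschitz i x y :
  `|proj x ord0 i - proj y ord0 i| <= \sum_j `|x ord0 j - y ord0 j|.
Proof.
have s0 : 0 <= \sum_j `|x ord0 j - y ord0 j| by rewrite sumr_ge0.
rewrite -(ler_sqr (normr_ge0 _) s0) real_normK ?num_real//.
have := sqr_coord_le (proj x - proj y) i; rewrite !mxE => /le_trans; apply.
apply: le_trans (proj_nonexpansive x y) _.
have -> : \sum_j `|x ord0 j - y ord0 j| = \sum_j `|(x - y) ord0 j|.
  by apply: eq_bigr => j _; rewrite !mxE.
exact: vdot_le_sqr_sum.
Qed.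

End projection.

(** * Measurable structure on row vectors *)

Section rV_measurable.
Context {R : realType} {dim : nat}.
(** Row vectors equipped with the cylinder sigma-algebra as their measurable structure, so that
    [rV_borel] is measurability by conversion. *)
Definition rVT := g_sigma_algebraType (@rV_cylinders R dim).

Lemma rVT_measurableE (E : set rVT) : measurable E = rV_borel E.
Proof. by []. Qed.

Lemma measurable_coord i : measurable_fun [set: rVT] (fun v : rVT => v ord0 i).
Proof.
move=> _ A mA; rewrite setTI; apply: sub_sigma_algebra.
by exists i, A.
Qed.

Lemma measurable_fun_rV d (T : measurableType d) (h : T -> rVT) :
  (forall i, measurable_fun setT (fun x => h x ord0 i)) -> measurable_fun setT h.
Proof.
move=> mh.
apply: (@measurability _ _ T rVT setT h (@rV_cylinders R dim)) => //.
by move=> _ [_ [i [A [mA ->]] <-]]; rewrite setTI; have := mh i measurableT _ mA; rewrite setTI.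
Qed.

(** The sigma-algebra is given by cylinders and not by open sets, so continuity does not apply
    directly. Rounding the coordinates down to the grid of mesh 1/(m+1) makes F a function with
    countably many values on measurable cells, and F is the pointwise limit of these. *)
Lemma measurable_lipschitz (F : rVT -> R) (C : R) :
  (forall u v, `|F u - F v| <= C * \sum_i `|u ord0 i - v ord0 i|) ->
  measurable_fun setT F.
Proof.
move=> FL.
pose grid (m : nat) (k : {ffun 'I_dim -> int}) : rVT := \row_i ((k i)%:~R / m.+1%:R).
pose code (m : nat) (v : rVT) : {ffun 'I_dim -> int} := [ffun i => Num.floor (m.+1%:R * v ord0 i)].
have mcode m k : measurable (code m @^-1` [set k]).
  have -> : code m @^-1` [set k] = \bigcap_(i in [set: 'I_dim])
      ((fun v : rVT => v ord0 i) @^-1` [set x : R | (k i)%:~R <= m.+1%:R * x < (k i + 1)%:~R]).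
    apply/seteqP; split=> [v /= kv i _ /=|v /= kv].
      by rewrite -kv ffunE floor_le floorD1_gt.
    apply/ffunP => i; rewrite ffunE; apply: floor_def.
    by have := kv i I.
  apply: fin_bigcap_measurable => // i _.
  rewrite -[X in measurable X]setTI; apply: measurable_coord => //.
  have -> : [set x : R | (k i)%:~R <= m.+1%:R * x < (k i + 1)%:~R] =
     `[(k i)%:~R / m.+1%:R, (k i + 1)%:~R / m.+1%:R[%classic.
    apply/seteqP; split=> x /=; rewrite in_itv/= ler_pdivrMr// ltr_pdivlMr// mulrC//.
  exact: measurable_itv.
apply: (@measurable_fun_cvg _ _ _ _ (fun m v => F (grid m (code m v)))) => [m|v _].
  move=> _ A mA; rewrite setTI.
  have -> : (fun v => F (grid m (code m v))) @^-1` A =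
     \bigcup_(k in [set: {ffun 'I_dim -> int}])
       (if `[< A (F (grid m k)) >] then code m @^-1` [set k] else set0).
    apply/seteqP; split=> [v /= Av|v /= [k _]].
      by exists (code m v) => //; case: asboolP.
    by case: asboolP => // Ak /= ->.
  apply: countable_bigcupT_measurable => [|k]; first exact: countableP.
  by case: ifP.
have bnd m : `|F (grid m (code m v)) - F v| <= `|C| * dim%:R * m.+1%:R^-1.
  apply: le_trans (FL _ _) _.
  apply: (@le_trans _ _ (`|C| * \sum_i `|grid m (code m v) ord0 i - v ord0 i|)).
    by rewrite ler_wpM2r ?ler_norm// sumr_ge0.
  rewrite -mulrA ler_wpM2l//.
  apply: (@le_trans _ _ (\sum_(i < dim) m.+1%:R^-1)); last first.
    by rewrite sumr_const card_ord mulr_natl.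
  apply: ler_sum => i _; rewrite !mxE ffunE.
  set x := m.+1%:R * v ord0 i.
  have x1 := floor_le x; have x2 := floorD1_gt x; rewrite intrD in x2.
  have m0 : 0 < m.+1%:R :> R by [].
  have -> : v ord0 i = x / m.+1%:R by rewrite /x mulrC mulKf.
  rewrite -mulrBl normrM [X in _ * X]gtr0_norm ?invr_gt0// -[leRHS]mul1r.
  rewrite ler_pM2r ?invr_gt0// ler_norml; lra.
apply/cvgrPdist_le => e e0; rewrite /=.
near=> m; rewrite distrC; apply: le_trans (bnd m) _.
rewrite ler_pdivrMr// [e * _]mulrC -ler_pdivrMr//.
apply: le_trans (_ : m%:R <= _); last by rewrite ler_nat.
near: m; exact: nbhs_infty_ger.
Unshelve. all: end_near.
Qed.

Lemma measurable_proj (W : set 'rV[R]_dim) (proj : 'rV[R]_dim -> 'rV[R]_dim) :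
  convex_subset W ->
  (forall x, W (proj x) /\ forall w, W w -> vnorm (proj x - x) <= vnorm (w - x)) ->
  measurable_fun [set: rVT] (proj : rVT -> rVT).
Proof.
move=> convW projP; apply: measurable_fun_rV => i.
apply: (@measurable_lipschitz _ 1) => u v; rewrite mul1r.
exact: (@proj_coord_lipschitz _ _ W).
Qed.

End rV_measurable.

(** * Independence *)

Section integral_weighted.
Local Open Scope ereal_scope.
Context d d' (Omega : measurableType d) (T : measurableType d') (R : realType).
Variables (P : {measure set Omega -> \bar R}) (nu : {measure set T -> \bar R}).
Variables (X : Omega -> T) (g : Omega -> R).
Hypothesis mX : measurable_fun setT X.
Hypothesis mg : measurable_fun setT g.
Hypothesis g0 : forall w, (0 <= g w)%R.
Hypothesis nuE : forall A, measurable A ->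
  nu A = \int[P]_w (\1_A (X w) * g w)%:E.

Import HBNNSimple.

Let mindX A : measurable A -> measurable_fun setT (fun w => \1_A (X w) : R).
Proof. by move=> mA; apply: (measurableT_comp _ mX). Qed.

Lemma integral_weighted_nnsfun (h : {nnsfun T >-> R}) :
  \int[nu]_x (h x)%:E = \int[P]_w (h (X w) * g w)%:E.
Proof.
under [LHS]eq_integral do rewrite fimfunE -fsumEFin//.
rewrite [LHS]ge0_integral_fsum//; last 2 first.
  - by move=> r; exact/measurable_EFinP/measurableT_comp.
  - by move=> n x _; rewrite EFinM nnfun_muleindic_ge0.
have h1 r : measurable_fun setT (fun w => (\1_(h @^-1` [set r]) (X w) * g w)%:E).
  by apply/measurable_EFinP/measurable_funM => //; exact: mindX.
transitivity (\int[P]_w (\sum_(r \in range h)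
    (r * (\1_(h @^-1` [set r]) (X w) * g w))%:E)); last first.
  apply: eq_integral => w _; rewrite fsumEFin//; congr EFin.
  by rewrite [in RHS]fimfunE mulr_fsuml//; apply: eq_fsbigr => r _; rewrite mulrA.
have ge r w : 0 <= (r * (\1_(h @^-1` [set r]) (X w) * g w))%:E.
  rewrite lee_fin indicE; have [/set_mem/= <-|_] := boolP (X w \in h @^-1` [set r]).
    by rewrite mul1r mulr_ge0.
  by rewrite mul0r mulr0.
rewrite ge0_integral_fsum//; last first.
  by move=> r; under eq_fun do rewrite EFinM; exact: measurable_funeM.
apply: eq_fsbigr => r _; rewrite integralZl_indic_nnsfun//.
rewrite integral_indic// setIT nuE//.
have [r0|r0] := leP 0%R r.
  rewrite -ge0_integralZl_EFin//.
  by move=> w _; rewrite lee_fin mulr_ge0.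
rewrite preimage_nnfun0// integral0_eq ?mule0//; last by move=> w _; rewrite indic0 mul0r.
by rewrite integral0_eq// => w _; rewrite indic0 mul0r mulr0.
Qed.

(** nu is the image under X of the measure of density g, so this is change of variables and of
    density at once. It serves for the normal density (X the identity), for laws of random variables
    (g = 1) and for restriction to an event (g an indicator). *)
Lemma ge0_integral_weighted (f : T -> \bar R) : measurable_fun setT f ->
  (forall x, 0 <= f x) -> \int[nu]_x f x = \int[P]_w (f (X w) * (g w)%:E).
Proof.
move=> mf f0; pose f_ := nnsfun_approx measurableT mf.
transitivity (limn (fun n => \int[nu]_x (f_ n x)%:E)).
  rewrite -monotone_convergence//=.
  - by apply: eq_integral => x _; apply/esym/cvg_lim => //=; exact: cvg_nnsfun_approx.
  - by move=> n; exact: measurableT_comp.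
  - by move=> n x _; rewrite lee_fin.
  - by move=> x _ a b ab; rewrite lee_fin//; exact/lefP/nd_nnsfun_approx.
under eq_fun do rewrite integral_weighted_nnsfun.
rewrite -monotone_convergence//=.
- apply: eq_integral => w _; apply/cvg_lim => //=.
  under eq_fun do rewrite EFinM.
  apply: cvgeZr => //; exact: cvg_nnsfun_approx.
- move=> n; apply/measurable_EFinP/measurable_funM => //.
  by apply: measurableT_comp => //.
- by move=> n x _; rewrite lee_fin mulr_ge0.
- move=> x _ a b ab; rewrite lee_fin ler_wpM2r//; exact/lefP/nd_nnsfun_approx.
Qed.

End integral_weighted.

Section indep.
Local Open Scope ereal_scope.
Context d (Omega : measurableType d) (R : realType) (P : probability Omega R).

(** Uniqueness of finite measures on a pi-system: A |-> P(xi in A, D) and c times the law of xi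
    agree on G. The constant c stands for the probability of D. *)
Lemma indep_generated d1 (T : measurableType d1) (G : set (set T))
    (xi : Omega -> T) (D : set Omega) (c : R) :
  measurable_fun setT xi -> measurable D -> (0 <= c)%R ->
  measurable = <<s G >> -> setI_closed G -> G setT ->
  (forall A, G A -> P (xi @^-1` A `&` D) = c%:E * P (xi @^-1` A)) ->
  forall A, measurable A -> P (xi @^-1` A `&` D) = c%:E * P (xi @^-1` A).
Proof.
move=> mxi mD c0 mG GI GT H A mA.
pose xi' : {mfun Omega >-> T} := HB.pack xi (isMeasurableFun.Build _ _ _ _ _ mxi).
pose m2 := mscale (NngNum c0) (distribution P xi').
pose m1 := pushforward (mrestr P mD) xi'.
have : m1 A = m2 A.
  apply: (@measure_unique _ _ _ G (fun=> setT)) => //.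
  - by rewrite bigcup_const.
  - move=> k; rewrite /m1 /pushforward /mrestr /=.
    by apply: (@le_lt_trans _ _ 1); [apply: probability_le1; rewrite preimage_setT setTI|exact: ltry].
by [].
Qed.

(** Restricted to D, the law of (xi, eta) is c times the product of the laws: it suffices to check
    rectangles, and Tonelli does the rest. *)
Lemma integral_indep d1 d2 (T1 : measurableType d1) (T2 : measurableType d2)
    (xi : Omega -> T1) (eta : Omega -> T2) (D : set Omega) (c : R)
    (F : T1 * T2 -> \bar R) :
  measurable_fun setT xi -> measurable_fun setT eta -> measurable D -> (0 <= c)%R ->
  (forall A B, measurable A -> measurable B ->
    P (xi @^-1` A `&` eta @^-1` B `&` D) = c%:E * (P (xi @^-1` A) * P (eta @^-1` B))) ->
  measurable_fun setT F -> (forall x, 0 <= F x) ->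
  \int[P]_w (F (xi w, eta w) * (\1_D w)%:E) =
  c%:E * \int[P]_w \int[P]_w' F (xi w, eta w').
Proof.
move=> mxi meta mD c0 H mF F0.
pose mxi' := isMeasurableFun.Build _ _ _ _ _ mxi.
pose xi' : {mfun Omega >-> T1} := HB.pack xi mxi'.
pose meta' := isMeasurableFun.Build _ _ _ _ _ meta.
pose eta' : {mfun Omega >-> T2} := HB.pack eta meta'.
pose m1 := [the probability _ _ of distribution P xi'].
pose m2 := [the probability _ _ of distribution P eta'].
have mj : measurable_fun setT (fun w => (xi w, eta w)) by exact: measurable_fun_pair.
pose nu := mscale (NngNum c0) (m1 \x m2).
have nuE A : measurable A -> nu A = \int[P]_w (\1_A (xi w, eta w) * \1_D w)%:E.
  move=> mA; pose mj' : {mfun Omega >-> (T1 * T2)%type} := HB.pack (fun w => (xi w, eta w)) (isMeasurableFun.Build _ _ _ _ _ mj).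
  transitivity (pushforward (mrestr P mD) mj' A); last first.
    rewrite /pushforward /mrestr -[X in P X]setIT -integral_indic//; last first.
      by apply: measurableI => //; have := mj measurableT _ mA; rewrite setTI.
    by apply: eq_integral => w _; rewrite indicI.
  pose G : set (set (T1 * T2)) :=
    [set C | exists A, measurable A /\ exists B, measurable B /\ C = A `*` B].
  apply: (@measure_unique _ _ _ G (fun=> setT)) => //.
  - rewrite measurable_prod_measurableType //; congr (<<s _ >>).
    rewrite predeqE; split => [[A' mA' [B mB <-]]|[A' [mA' [B [mB ->]]]]].
      by exists A'; split => //; exists B.
    by exists A' => //; exists B.
  - move=> /= _ _ [X1 [mX1 [X2 [mX2 ->]]]] [Y1 [mY1 [Y2 [mY2 ->]]]].
    rewrite -setXI; exists (X1 `&` Y1); split; first exact: measurableI.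
    by exists (X2 `&` Y2); split => //; exact: measurableI.
  - by move=> _; exists setT; split => //; exists setT; rewrite setXTT.
  - by rewrite bigcup_const.
  - move=> _ [A1 [mA1 [B1 [mB1 ->]]]]; change (c%:E * (m1 \x m2) (A1 `*` B1) = P ((fun w => (xi w, eta w)) @^-1` (A1 `*` B1) `&` D)).
    rewrite product_measure1E//=.
    by rewrite -H//; congr (P (_ `&` _)).
  - move=> _; change (c%:E * (m1 \x m2) setT < +oo); rewrite -setXTT product_measure1E//= !probability_setT.
    by rewrite mule1 ltry.
have mD' : measurable_fun setT (\1_D : Omega -> R) by exact: measurable_indic.
have := @ge0_integral_weighted _ _ _ _ _ P nu _ _ mj mD' _ nuE F mF F0.
move=> <-; last by move=> w; rewrite indicE.
rewrite ge0_integral_mscale//; congr (_ * _).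
rewrite fubini_tonelli1//.
rewrite ge0_integral_pushforward//.
- rewrite preimage_setT; apply: eq_integral => w _ /=; rewrite /fubini_F.
  rewrite ge0_integral_pushforward// ?preimage_setT//.
  exact: measurableT_comp.
- exact: measurable_fun_fubini_tonelli_F.
- by move=> x _; exact: integral_ge0.
Qed.

End indep.

(** * Gaussian vectors *)

Section boxes.
Context {R : realType} {dim : nat}.
Local Notation V := (@rVT R dim).

(** Cylinders are not closed under intersection; boxes are the pi-system on which laws of vectors
    are compared. *)
Definition rV_boxes : set (set V) :=
  [set E | exists A : 'I_dim -> set R,
    (forall i, measurable (A i)) /\ E = [set v : V | forall i, A i (v ord0 i)]].

Lemma measurable_box (A : 'I_dim -> set R) : (forall i, measurable (A i)) ->
  measurable [set v : V | forall i, A i (v ord0 i)].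
Proof.
move=> mA; have -> : [set v : V | forall i, A i (v ord0 i)] =
    \bigcap_(i in [set: 'I_dim]) ((fun v : V => v ord0 i) @^-1` A i).
  by apply/seteqP; split=> [v vA i _|v vA i]; [exact: vA|exact: vA i I].
apply: fin_bigcap_measurable => // i _.
by have := measurable_coord i measurableT _ (mA i); rewrite setTI.
Qed.

Lemma rV_boxes_setI : setI_closed rV_boxes.
Proof.
move=> _ _ [A [mA ->]] [A' [mA' ->]]; exists (fun i => A i `&` A' i); split.
  by move=> i; exact: measurableI.
by apply/seteqP; split=> v /= h; [case: h => h h' i; split|split=> i; case: (h i)].
Qed.

Lemma rV_boxes_setT : rV_boxes setT.
Proof. by exists (fun=> setT); split=> //; apply/seteqP; split. Qed.

Lemma rV_boxes_generate : (@measurable _ V) = <<s rV_boxes >>.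
Proof.
apply/seteqP; split=> E.
  apply: sub_sigma_algebra2 => _ [i [A [mA ->]]].
  exists (fun j => if j == i then A else setT); split.
    by move=> j; case: ifP.
  apply/seteqP; split=> [v Av j|v /(_ i)]; last by rewrite eqxx.
  by case: eqP => [->|].
apply: smallest_sub; first exact: sigma_algebra_measurable.
by move=> _ [A [mA ->]]; exact: measurable_box.
Qed.

End boxes.

(** * Translation of the one-dimensional normal law *)

Section normal_shift.
Local Open Scope ereal_scope.
Context {R : realType}.
Implicit Type f : R -> \bar R.

(** Lebesgue measure is determined by half-open intervals, whose length a translation preserves. *)
Lemma lebesgue_integral_shift (c : R) (f : measurableTypeR R -> \bar R) :
  measurable_fun setT f -> (forall x, 0 <= f x) ->
  \int[lebesgue_measure]_x f (x + c)%R = \int[lebesgue_measure]_x f x.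
Proof.
move=> mf f0.
have msh : measurable_fun setT (fun x : measurableTypeR R => (x + c)%R : measurableTypeR R).
  exact: measurable_funD.
pose sh : {mfun measurableTypeR R >-> measurableTypeR R} :=
  HB.pack (fun x : measurableTypeR R => (x + c)%R : measurableTypeR R) (isMeasurableFun.Build _ _ _ _ _ msh).
pose m := pushforward (@lebesgue_measure R) sh.
have mE A : measurable A -> lebesgue_measure A = m A.
  apply: lebesgue_measure_unique => _ [[a b] _ <-] /=.
  rewrite /m /pushforward.
  have -> : sh @^-1` `]a, b]%classic = `](a - c)%R, (b - c)%R]%classic.
    by apply/seteqP; split=> x /=; rewrite !in_itv/= ltrBlDr lerBrDr.
  rewrite !lebesgue_measure_itv/= !lte_fin ltrD2r -!EFinB; case: ifP => // _.
  by congr EFin; ring.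
rewrite [RHS](eq_measure_integral m); last by move=> A mA _; exact: mE.
by rewrite ge0_integral_pushforward// preimage_setT.
Qed.

Lemma integral_normal_prob (s : R) f : measurable_fun setT f -> (forall x, 0 <= f x) ->
  \int[normal_prob 0 s]_x f x = \int[lebesgue_measure]_x (f x * (normal_pdf 0 s x)%:E).
Proof.
move=> mf f0.
have nuE A : measurable A ->
    normal_prob 0 s A = \int[lebesgue_measure]_x (\1_A x * normal_pdf 0 s x)%:E.
  move=> mA; rewrite /normal_prob integral_mkcond.
  congr (integral _ _ _); apply/funext => x.
  by rewrite /patch indicE; case: ifP => _; rewrite ?mul1r ?mul0r.
exact: (@ge0_integral_weighted _ _ _ _ R lebesgue_measure
  (normal_prob 0 s) id (normal_pdf 0 s) (@measurable_id _ _ setT) (measurable_normal_pdf 0 s)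
  (normal_pdf_ge0 0 s) nuE f mf f0).
Qed.

Lemma normal_pdf_shift (s c x : R) : s != 0%R ->
  normal_pdf 0 s (x - c)%R = (expR ((c * x - c ^+ 2 / 2) / s ^+ 2) * normal_pdf 0 s x)%R.
Proof.
move=> s0; rewrite normal_pdfE// mulrCA -expRD; congr (_ * expR _)%R.
rewrite !subr0; field; exact: s0.
Qed.

Lemma normal_prob_shift (s c : R) f : s != 0%R -> measurable_fun setT f -> (forall x, 0 <= f x) ->
  \int[normal_prob 0 s]_x f (x + c)%R =
  \int[normal_prob 0 s]_x (f x * (expR ((c * x - c ^+ 2 / 2) / s ^+ 2))%:E).
Proof.
move=> s0 mf f0.
have me : measurable_fun setT (fun x : R => expR ((c * x - c ^+ 2 / 2) / s ^+ 2)%R).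
  apply: measurableT_comp => //; apply: measurable_funM => //.
  by apply: measurable_funB => //; exact: measurable_funM.
have mh : measurable_fun setT (fun x : R => f x * (expR ((c * x - c ^+ 2 / 2) / s ^+ 2)%R)%:E * (normal_pdf 0 s x)%:E).
  apply: emeasurable_funM; last first.
    by apply/measurable_EFinP; exact: measurable_normal_pdf.
  by apply: emeasurable_funM => //; exact/measurable_EFinP.
rewrite integral_normal_prob//; last first.
  by apply: measurableT_comp => //; exact: measurable_funD.
rewrite integral_normal_prob; last 2 first.
- by apply: emeasurable_funM => //; exact/measurable_EFinP.
- by move=> x; rewrite mule_ge0// lee_fin expR_ge0.
rewrite -(lebesgue_integral_shift c (fun x => f x * (expR ((c * x - c ^+ 2 / 2) / s ^+ 2))%:E * (normal_pdf 0 s x)%:E)).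
- apply: eq_integral => x _.
  by rewrite -muleA -EFinM -normal_pdf_shift// addrK.
- exact: mh.
- by move=> x; rewrite !mule_ge0// lee_fin ?expR_ge0 ?normal_pdf_ge0.
Qed.

End normal_shift.

(** * The Cameron-Martin formula for Gaussian vectors *)

Section cameron_martin.
Local Open Scope ereal_scope.
Context d (Omega : measurableType d) (R : realType) (P : probability Omega R).
Context (dim : nat) (B : 'I_dim -> Omega -> R) (s : R).
Local Notation V := (@rVT R dim).
Hypothesis s0 : s != 0%R.
Hypothesis mB : forall i, measurable_fun setT (B i).
Hypothesis lawB : forall i A, measurable A -> P (B i @^-1` A) = normal_prob 0 s A.
Hypothesis indB : forall A : 'I_dim -> set R, (forall i, measurable (A i)) ->
  P [set w | forall i, A i (B i w)] = (\prod_i fine (P (B i @^-1` A i)))%:E.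

Let b (w : Omega) : V := \row_i B i w.

Lemma measurable_noise : measurable_fun setT b.
Proof.
apply: measurable_fun_rV => i; under eq_fun do rewrite mxE; exact: mB.
Qed.

Lemma measurable_funV_add (v : V) : measurable_fun setT (fun x : V => (x + v)%R : V).
Proof.
apply: measurable_fun_rV => i; under eq_fun do rewrite mxE.
by apply: measurable_funD => //; exact: measurable_coord.
Qed.

(** The noise with its k-th coordinate set to 0: the full vector is [rest k] plus B k times the k-th
    basis vector, a sum of independent terms. *)
Let rest (k : 'I_dim) (w : Omega) : V := \row_i (if i == k then 0%R else B i w).

Let measurable_rest k : measurable_fun setT (rest k).
Proof.
apply: measurable_fun_rV => i; under eq_fun do rewrite mxE.
by case: eqP => _; [exact: measurable_cst|exact: mB].
Qed.

Let indep_rest k (A : set V) (C : set R) : measurable A -> measurable C ->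
  P (rest k @^-1` A `&` B k @^-1` C `&` setT) = 1%:E * (P (rest k @^-1` A) * P (B k @^-1` C)).
Proof.
move=> mA mC; rewrite setIT mul1e.
have mBC : measurable (B k @^-1` C) by have := mB k measurableT _ mC; rewrite setTI.
have fP D : measurable D -> P D = (fine (P D))%:E.
  by move=> mD; rewrite fineK// fin_num_measure.
have c0 : (0 <= fine (P (B k @^-1` C)))%R by rewrite fine_ge0.
rewrite muleC (fP _ mBC).
apply: (@indep_generated _ _ _ _ _ _ (@rV_boxes R dim)) => //.
- exact: rV_boxes_generate.
- exact: rV_boxes_setI.
- exact: rV_boxes_setT.
move=> _ [A' [mA' ->]].
(* The k-th coordinate of [rest k] is constantly 0, so a box whose k-th side misses 0 has empty
   preimage, and the k-th side of any other box imposes no condition. *)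
have [A0|A0] := pselect (A' k 0%R); last first.
  rewrite (_ : rest k @^-1` _ = set0) ?set0I ?measure0 ?mule0//.
  by apply/seteqP; split=> w //= /(_ k); rewrite mxE eqxx.
have mA1 i : measurable (if i == k then C else A' i) by case: ifP.
have mA2 i : measurable (if i == k then setT else A' i) by case: ifP.
have -> : rest k @^-1` [set v : V | forall i, A' i (v ord0 i)] `&` B k @^-1` C =
    [set w | forall i, (if i == k then C else A' i) (B i w)].
  apply/seteqP; split=> [w [/= h Cw] i|w /= h].
    by have := h i; rewrite mxE; case: eqP => // ->.
  split=> [i|]; last by have := h k; rewrite eqxx.
  by rewrite mxE; have := h i; case: eqP => // ->.
have -> : rest k @^-1` [set v : V | forall i, A' i (v ord0 i)] =
    [set w | forall i, (if i == k then setT else A' i) (B i w)].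
  apply/seteqP; split=> [w /= h i|w /= h i].
    by have := h i; rewrite mxE; case: eqP.
  by rewrite mxE; have := h i; case: eqP => // ->.
rewrite (indB (fun i => if i == k then C else A' i))//.
rewrite (indB (fun i => if i == k then setT else A' i))// -EFinM; congr EFin.
rewrite (bigD1 k)//= eqxx [in RHS](bigD1 k)//= eqxx preimage_setT probability_setT mul1r.
by congr (_ * _)%R; apply: eq_bigr => i /negbTE ->.
Qed.

Lemma integral_normal_rv (k : 'I_dim) (f : R -> \bar R) : measurable_fun setT f ->
  (forall x, 0 <= f x) -> \int[P]_w f (B k w) = \int[normal_prob 0 s]_x f x.
Proof.
move=> mf f0.
have nuE A : measurable A ->
    normal_prob 0 s A = \int[P]_w (\1_A (B k w) * cst 1%R w)%:E.
  move=> mA; have mBA : measurable (B k @^-1` A).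
    by have := mB k measurableT _ mA; rewrite setTI.
  rewrite -(lawB k A mA) -[X in P X]setIT -integral_indic//.
  by apply: eq_integral => w _; rewrite mulr1.
have := @ge0_integral_weighted _ _ _ _ R P (normal_prob 0 s) (B k) (cst 1%R)
  (mB k) (measurable_cst _) (fun=> ler01) nuE f mf f0.
by move=> ->; apply: eq_integral => w _; rewrite mule1.
Qed.

Lemma cameron_martin_coord (k : 'I_dim) (c : R) (F : V -> \bar R) :
  measurable_fun setT F -> (forall x, 0 <= F x) ->
  \int[P]_w F (b w + c *: delta_mx ord0 k)%R =
  \int[P]_w (F (b w) * (expR ((c * B k w - c ^+ 2 / 2) / s ^+ 2))%:E).
Proof.
move=> mF F0.
have bE w : b w = (rest k w + B k w *: delta_mx ord0 k)%R.
  apply/rowP => i; rewrite !mxE eqxx /=.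
  by have [->|_] := eqVneq i k; rewrite ?mulr1 ?add0r ?mulr0 ?addr0.
pose H (z : V * R) := F (z.1 + z.2 *: delta_mx ord0 k)%R.
have mH0 : measurable_fun setT (fun z : V * R => (z.1 + z.2 *: delta_mx ord0 k)%R : V).
  apply: measurable_fun_rV => i; under eq_fun do rewrite !mxE.
  apply: measurable_funD; first exact: (measurableT_comp (measurable_coord i)).
  exact: measurable_funM.
have mH : measurable_fun setT H by exact: (measurableT_comp mF mH0).
pose H1 (z : V * R) := H (z.1, z.2 + c)%R.
have mH1 : measurable_fun setT H1.
  apply: (measurableT_comp mH); apply: measurable_fun_pair => //=.
  exact: measurable_funD.
have me : measurable_fun setT (fun x : R => expR ((c * x - c ^+ 2 / 2) / s ^+ 2)%R).
  apply: measurableT_comp => //; apply: measurable_funM => //.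
  by apply: measurable_funB => //; exact: measurable_funM.
pose H2 (z : V * R) := H z * (expR ((c * z.2 - c ^+ 2 / 2) / s ^+ 2))%:E.
have mH2 : measurable_fun setT H2.
  by apply: emeasurable_funM => //; apply/measurable_EFinP; exact: (measurableT_comp me).
have indT : \1_([set: Omega]) = cst 1%R :> (Omega -> R) by exact: indicT.
have g1 : \int[P]_w F (b w + c *: delta_mx ord0 k)%R = \int[P]_w \int[P]_w' H1 (rest k w, B k w').
  have := integral_indep _ _ _ P _ _ _ _ (rest k) (B k) setT 1%R H1 (measurable_rest k) (mB k) measurableT ler01 (indep_rest k) mH1 (fun=> F0 _).
  rewrite mul1e => <-; apply: eq_integral => w _.
  by rewrite indT mule1 /H1 /H /= bE scalerDl addrA.
have g2 : \int[P]_w (F (b w) * (expR ((c * B k w - c ^+ 2 / 2) / s ^+ 2))%:E) =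
    \int[P]_w \int[P]_w' H2 (rest k w, B k w').
  have := integral_indep _ _ _ P _ _ _ _ (rest k) (B k) setT 1%R H2 (measurable_rest k) (mB k) measurableT ler01 (indep_rest k) mH2 _.
  rewrite mul1e => <-; last by move=> z; rewrite mule_ge0 ?lee_fin ?expR_ge0//; exact: F0.
  by apply: eq_integral => w _; rewrite indT mule1 /H2 /H /= bE.
rewrite g1 g2; apply: eq_integral => w _.
have mHw : measurable_fun setT (fun x : R => H (rest k w, x)) by exact: measurableT_comp.
rewrite (integral_normal_rv k (fun x => H1 (rest k w, x))); last 2 first.
- exact: measurableT_comp.
- by move=> x; exact: F0.
rewrite (integral_normal_rv k (fun x => H2 (rest k w, x))); last 2 first.
- exact: measurableT_comp.
- by move=> x; rewrite mule_ge0 ?lee_fin ?expR_ge0//; exact: F0.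
exact: (normal_prob_shift s c (fun x => H (rest k w, x)) s0 mHw (fun=> F0 _)).
Qed.

(** The density of N(mu, s^2 I) with respect to N(0, s^2 I). *)
Definition gauss_lik (mu v : 'rV[R]_dim) : R := expR ((vdot mu v - vdot mu mu / 2) / s ^+ 2).

Lemma measurable_vdot (mu : 'rV[R]_dim) : measurable_fun setT (fun v : V => vdot mu v).
Proof.
apply: measurable_sum => i; apply: measurable_funM => //; exact: measurable_coord.
Qed.

Lemma measurable_gauss_lik mu : measurable_fun setT (fun v : V => gauss_lik mu v).
Proof.
apply: (measurableT_comp (@measurable_expR R)); apply: measurable_funM => //.
by apply: measurable_funB => //; exact: measurable_vdot.
Qed.

(** The shift is applied one coordinate at a time. F is generalized in the induction because the
    likelihood factors of the treated coordinates join the integrand. *)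
Theorem cameron_martin (mu : 'rV[R]_dim) (F : V -> \bar R) :
  measurable_fun setT F -> (forall x, 0 <= F x) ->
  \int[P]_w F (b w + mu)%R = \int[P]_w (F (b w) * (gauss_lik mu (b w))%:E).
Proof.
move=> mF F0.
pose m (r : seq 'I_dim) : V := (\sum_(i <- r) mu ord0 i *: delta_mx ord0 i)%R.
pose e (r : seq 'I_dim) (v : V) : R :=
  (\sum_(i <- r) (mu ord0 i * v ord0 i - mu ord0 i ^+ 2 / 2) / s ^+ 2)%R.
have me r : measurable_fun setT (fun v : V => expR (e r v)).
  apply: measurableT_comp => //; apply: measurable_sum => i.
  apply: measurable_funM => //; apply: measurable_funB => //.
  by apply: measurable_funM => //; exact: measurable_coord.
have key r : uniq r -> forall F : V -> \bar R, measurable_fun setT F -> (forall x, 0 <= F x) ->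
    \int[P]_w F (b w + m r)%R = \int[P]_w (F (b w) * (expR (e r (b w)))%:E).
  elim: r => [_ G mG G0|k r IH /= /andP[kr ur] G mG G0].
    apply: eq_integral => w _; rewrite /m /e !big_nil addr0 expR0 mule1//.
  (* The remaining shift leaves the k-th coordinate alone, so the factor already produced for k is
     unchanged by it. *)
  have mr0 : m r ord0 k = 0%R.
    rewrite /m summxE big_seq big1// => i ir; rewrite !mxE eqxx /=.
    by case: eqP => [ik|]; rewrite ?mulr0//; move: kr; rewrite ik ir.
  transitivity (\int[P]_w ((fun v : V => G (v + m r)%R) (b w + mu ord0 k *: delta_mx ord0 k)%R)).
    by apply: eq_integral => w _; rewrite /m big_cons addrA.
  rewrite (cameron_martin_coord k (mu ord0 k) (fun v : V => G (v + m r)%R)); last 2 first.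
  - exact: (measurableT_comp mG (measurable_funV_add (m r))).
  - by move=> x; exact: G0.
  pose G' (v : V) := G v * (expR ((mu ord0 k * v ord0 k - mu ord0 k ^+ 2 / 2) / s ^+ 2))%:E.
  transitivity (\int[P]_w G' (b w + m r)%R).
    by apply: eq_integral => w _; rewrite /G' !mxE mr0 addr0.
  rewrite (IH ur G'); first 1 last.
  - apply: emeasurable_funM => //; apply/measurable_EFinP.
    apply: measurableT_comp => //; apply: measurable_funM => //; apply: measurable_funB => //.
    by apply: measurable_funM => //; exact: measurable_coord.
  - by move=> x; rewrite mule_ge0// lee_fin expR_ge0.
  - apply: eq_integral => w _; rewrite /G' -muleA -EFinM -expRD; congr (_ * (expR _)%:E).
    by rewrite /e big_cons !mxE.
have mE : m (index_enum 'I_dim) = mu by rewrite [RHS]row_sum_delta.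
have := key _ (index_enum_uniq 'I_dim) F mF F0; rewrite mE => ->.
apply: eq_integral => w _.
congr (_ * (expR _)%:E); rewrite /e -mulr_suml; congr (_ / _)%R.
rewrite /vdot sumrB; congr (_ - _)%R; rewrite mulr_suml.
by apply: eq_bigr => i _; rewrite expr2.
Qed.

Lemma gauss_mgf (u : 'rV[R]_dim) :
  \int[P]_w (expR (vdot u (b w) / s ^+ 2))%:E = (expR (vdot u u / 2 / s ^+ 2))%:E.
Proof.
have := cameron_martin u (cst 1) (measurable_cst _) (fun=> lee01).
rewrite integral_cst//= probability_setT mule1 => h.
have -> : \int[P]_w (expR (vdot u (b w) / s ^+ 2))%:E =
    \int[P]_w ((expR (vdot u u / 2 / s ^+ 2))%:E * (1 * (gauss_lik u (b w))%:E)).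
  apply: eq_integral => w _; rewrite mul1e -EFinM -expRD; congr (expR _)%:E.
  by rewrite -mulrDl addrC subrK.
rewrite ge0_integralZl_EFin ?expR_ge0//.
- by rewrite -h mule1.
- by move=> w _; rewrite mul1e lee_fin expR_ge0.
- under eq_fun do rewrite mul1e; apply/measurable_EFinP.
  apply: (measurableT_comp (measurable_gauss_lik u)); exact: measurable_noise.
Qed.

End cameron_martin.

(** * One sampled step *)

Set Implicit Arguments.
Unset Strict Implicit.

(** The hypothesis at t = r Y / X, multiplied by X^l Y^(1-l). Having all t available is what allows
    a rescaling that depends on the point. *)
Lemma tangent_rescale (R : realType) (l r X Y M f f' : R) :
  0 < r -> 0 < X -> 0 < Y ->
  (forall t, 0 < t -> l * t `^ (l - 1) * f <= M + (l - 1) * t `^ l * f') ->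
  l * r `^ (l - 1) * (X * f) <= M * (X `^ l * Y `^ (1 - l)) + (l - 1) * r `^ l * (Y * f').
Proof.
move=> r0 X0 Y0 H.
have XYn (e : R) : X `^ e != 0 /\ Y `^ e != 0 by rewrite !gt_eqF ?powR_gt0.
have t0 : 0 < r * Y / X by rewrite divr_gt0 ?mulr_gt0.
have pE (e : R) : (r * Y / X) `^ e = r `^ e * Y `^ e * X `^ (- e).
  rewrite powRM ?invr_ge0 ?mulr_ge0 ?(ltW r0) ?(ltW X0) ?(ltW Y0)//.
  rewrite powRM ?(ltW r0) ?(ltW Y0)//; congr (_ * _).
  by rewrite -powR_inv1 ?(ltW X0)// -powRrM mulN1r.
have k0 : 0 < X `^ l * Y `^ (1 - l) by rewrite mulr_gt0 ?powR_gt0.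
have := H _ t0; rewrite -(ler_pM2l k0) mulrDr (mulrC _ M) 2!pE opprB.
have YY : Y `^ (1 - l) * Y `^ (l - 1) = 1.
  by rewrite -powRD ?(gt_eqF Y0) ?implybT// (_ : 1 - l + (l - 1) = 0) ?powRr0//; lra.
have XX : X `^ l * X `^ (1 - l) = X.
  by rewrite -powRD ?(gt_eqF X0) ?implybT// (_ : l + (1 - l) = 1) ?powRr1 ?(ltW X0)//; lra.
have YY' : Y `^ (1 - l) * Y `^ l = Y.
  by rewrite -powRD ?(gt_eqF Y0) ?implybT// (_ : 1 - l + l = 1) ?powRr1 ?(ltW Y0)//; lra.
have XX' : X `^ l * X `^ (- l) = 1.
  by rewrite -powRD ?(gt_eqF X0) ?implybT// subrr powRr0.
have -> : X `^ l * Y `^ (1 - l) * (l * (r `^ (l - 1) * Y `^ (l - 1) * X `^ (1 - l)) * f) =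
   l * r `^ (l - 1) * ((X `^ l * X `^ (1 - l)) * (Y `^ (1 - l) * Y `^ (l - 1)) * f) by ring.
have -> : X `^ l * Y `^ (1 - l) * ((l - 1) * (r `^ l * Y `^ l * X `^ (- l)) * f') =
   (l - 1) * r `^ l * ((X `^ l * X `^ (- l)) * (Y `^ (1 - l) * Y `^ l) * f') by ring.
by rewrite XX YY XX' YY' mulr1 mul1r.
Qed.

(** When x, y, z are the squared distances u-a, v-a, u-v over s^2, the left side is the mean of (A -
    B)^2 under the law centred at a, and its largest value is at x = y = z = tau. In the variables r
    = exp(x/2), t = exp(y/2), r is raised to exp(tau/2), then t. *)
Lemma expR_cross_le (R : realType) (tau x y z : R) :
  0 <= x <= tau -> 0 <= y <= tau -> z <= tau ->
  expR x + expR y - 2 * expR ((x + y - z) / 2) <= 2 * (expR tau - expR (tau / 2)).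
Proof.
move=> /andP[x0 x1] /andP[y0 y1] z1.
pose rho := expR (tau / 2); pose r := expR (x / 2); pose t := expR (y / 2).
have sq (v : R) : expR v = expR (v / 2) * expR (v / 2) by rewrite -expRD; congr expR; lra.
have rho0 : 0 < rho := expR_gt0 _.
have r1 : 1 <= r by rewrite -[leLHS]expR0 ler_expR; lra.
have t1 : 1 <= t by rewrite -[leLHS]expR0 ler_expR; lra.
have rr : r <= rho by rewrite ler_expR; lra.
have tr : t <= rho by rewrite ler_expR; lra.
have cross : r * t <= rho * expR ((x + y - z) / 2).
  by rewrite -!expRD ler_expR; lra.
rewrite (sq x) (sq y) (sq tau) -/rho -/r -/t.
have h1 : rho * (r * r) - 2 * (r * t) <= rho * (rho * rho) - 2 * (rho * t).
  have e : 0 <= (rho - r) * (rho * (rho + r) - 2 * t).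
    rewrite mulr_ge0//; first by lra.
    have : rho * 2 <= rho * (rho + r) by rewrite ler_pM2l//; lra.
    lra.
  lra.
have h2 : rho * (t * t - 2 * t) <= rho * (rho * rho - 2 * rho).
  rewrite ler_pM2l//; have : 0 <= (rho - t) * (rho + t - 2) by rewrite mulr_ge0; lra.
  lra.
rewrite -(ler_pM2l rho0); lra.
Qed.

(** * Expectations as a relation *)

Section hasE.
Context d (Omega : measurableType d) (R : realType) (P : probability Omega R).
Implicit Types f g : Omega -> R.

(** The value travels with integrability, so the expectation of a long linear combination is
    assembled term by term without separate integrability goals. *)
Definition hasE f (m : R) :=
  P.-integrable setT (EFin \o f) /\ (\int[P]_w (f w)%:E = m%:E)%E.

Lemma hasE_ext f g m k : f =1 g -> m = k -> hasE f m -> hasE g k.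
Proof. by move=> /funext -> ->. Qed.

Lemma hasE_add f g m k : hasE f m -> hasE g k -> hasE (fun w => f w + g w) (m + k).
Proof.
move=> [fi fm] [gi gk]; split; first exact: (integrableD measurableT fi gi).
under eq_integral do rewrite EFinD.
by rewrite (integralD measurableT fi gi) /= fm gk.
Qed.

Lemma hasE_scale c f m : hasE f m -> hasE (fun w => c * f w) (c * m).
Proof.
move=> [fi fm]; split; first exact: (integrableZl measurableT c fi).
under eq_integral do rewrite EFinM.
by rewrite (integralZl measurableT fi) /= fm.
Qed.

Lemma hasE_le f g m k : hasE f m -> hasE g k -> (forall w, f w <= g w) -> m <= k.
Proof.
move=> [fi fm] [gi gk] fg; rewrite -lee_fin -fm -gk.
by apply: le_integral => // w _; rewrite lee_fin.
Qed.

Lemma hasE_ge0 f m : (forall w, 0 <= f w) -> measurable_fun setT f ->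
  (\int[P]_w (f w)%:E = m%:E)%E -> hasE f m.
Proof.
move=> f0 mf fm; split=> //; apply/integrableP; split; first exact/measurable_EFinP.
under eq_integral do rewrite /= ger0_norm//.
by rewrite fm ltry.
Qed.

End hasE.

Section sampled_step.
Context d (Omega : measurableType d) (R : realType) (P : probability Omega R).
Context (dim : nat) (b : Omega -> @rVT R dim) (s : R).
Hypothesis s0 : s != 0.
Hypothesis mb : measurable_fun setT b.
Hypothesis mgf : forall u, hasE P (fun w => expR (vdot u (b w) / s ^+ 2))
                                  (expR (vdot u u / 2 / s ^+ 2)).
Local Notation lik := (gauss_lik R dim s).
Local Notation hasE := (hasE P).
Let s20 : s ^+ 2 != 0. Proof. by rewrite expf_neq0. Qed.

Lemma gauss_lik_gt0 (u v : 'rV[R]_dim) : 0 < lik u v.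
Proof. exact: expR_gt0. Qed.

Lemma hasE_expR (c : R) (u : 'rV[R]_dim) :
  hasE (fun w => expR ((vdot u (b w) + c) / s ^+ 2)) (expR ((vdot u u / 2 + c) / s ^+ 2)).
Proof.
apply: hasE_ext (hasE_scale (expR (c / s ^+ 2)) (mgf u)).
- by move=> w; rewrite -expRD -mulrDl addrC.
- by rewrite -expRD -mulrDl addrC.
Qed.

Lemma hasE_lik u : hasE (fun w => lik u (b w)) 1.
Proof.
apply: hasE_ext (hasE_expR (- (vdot u u / 2)) u) => //.
by rewrite subrr mul0r expR0.
Qed.

(** Powers of Gaussian likelihoods are again exponentials of a linear form, here with direction
    (1-h) a + h u; completing the square leaves only u - a. *)
Lemma hasE_lik_ratio_powR (a u : 'rV[R]_dim) (h : R) :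
  hasE (fun w => lik a (b w) * (lik u (b w) / lik a (b w)) `^ h)
    (expR (h * (h - 1) / 2 * (vdot (u - a) (u - a) / s ^+ 2))).
Proof.
apply: hasE_ext (hasE_expR (- ((1 - h) * vdot a a / 2 + h * vdot u u / 2))
  ((1 - h) *: a + h *: u)).
- move=> w; rewrite /gauss_lik -expRN -expRD -expRM -expRD; congr expR.
  by rewrite vdotDl !vdotZl; field.
- congr expR; rewrite !(vdotDl, vdotDr, vdotZl, vdotZr, vdotNl, vdotNr) (vdotC u a); by field.
Qed.

Lemma hasE_lik_ratio_mul (a u v : 'rV[R]_dim) :
  hasE (fun w => lik a (b w) * (lik u (b w) / lik a (b w)) * (lik v (b w) / lik a (b w)))
    (expR (vdot (u - a) (v - a) / s ^+ 2)).
Proof.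
apply: hasE_ext (hasE_expR (- (- vdot a a / 2 + vdot u u / 2 + vdot v v / 2))
  (u + v - a)).
- move=> w; rewrite /gauss_lik -!expRN -!expRD; congr expR.
  by rewrite !(vdotDl, vdotNl); field.
- congr expR; rewrite !(vdotDl, vdotDr, vdotNl, vdotNr) (vdotC u a) (vdotC v a) (vdotC v u); by field.
Qed.

Variables (tau q l : R).
Hypothesis tauP : 0 < tau <= 3 / 2.
Hypothesis l1 : 1 < l.
Hypothesis q0 : 0 < q.
Hypothesis q1 : q < 1.
Hypothesis hyp : q * l * expR (3 / 2 * tau * (l - 1)) <= tau / (1 + tau).
Variables (a u v : 'rV[R]_dim).
Hypothesis ua : vdot (u - a) (u - a) / s ^+ 2 <= tau.
Hypothesis va : vdot (v - a) (v - a) / s ^+ 2 <= tau.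
Hypothesis uv : vdot (u - v) (u - v) / s ^+ 2 <= tau.
Variables (psi psi' : @rVT R dim -> R) (M : R).
Hypothesis M0 : 0 <= M.
Hypothesis pc : forall x t, 0 < t ->
  l * t `^ (l - 1) * psi x <= M + (l - 1) * t `^ l * psi' x.
Variables (Fa Fa' Fu Fv' : R).
Hypothesis hFa : hasE (fun w => psi (b w) * lik a (b w)) Fa.
Hypothesis hFa' : hasE (fun w => psi' (b w) * lik a (b w)) Fa'.
Hypothesis hFu : hasE (fun w => psi (b w) * lik u (b w)) Fu.
Hypothesis hFv' : hasE (fun w => psi' (b w) * lik v (b w)) Fv'.

Let dot_ge0 (x : 'rV[R]_dim) : 0 <= vdot x x / s ^+ 2.
Proof. by rewrite divr_ge0 ?vdot_ge0 ?sqr_ge0. Qed.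

(** Here a is the gradient at an avoiding pair, common to both datasets; u and v are the gradients
    at one meeting pair for the two datasets. The tangent inequality is rescaled pointwise by the
    mixtures X and Y of likelihoods, then integrated. *)
Lemma sampled_step_mixture : q <= 1 / 3 -> forall r, 0 < r ->
  l * r `^ (l - 1) * ((1 - q) * Fa + q * Fu) <=
  M * (1 + 7 / 2 * q ^+ 2 * (l * (l - 1)) * tau) +
    (l - 1) * r `^ l * ((1 - q) * Fa' + q * Fv').
Proof.
have l1' : 1 < l := l1; have q0' : 0 < q := q0; have q1' : q < 1 := q1.
move=> q3 r r0.
have [] := mixture_moment_bound _ tau q l tauP _ l1 hyp; first by rewrite q0.
move=> k1 [k2 [h [k10 k20 h1 pw num]]].
set coef := l * (l - 1) / 2 * (q ^+ 2 / (1 - q)) in pw.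
have coef0 : 0 <= coef by rewrite /coef mulr_ge0 ?divr_ge0 ?mulr_ge0 ?sqr_ge0//; lra.
pose La w := lik a (b w).
pose A w := lik u (b w) / lik a (b w); pose B w := lik v (b w) / lik a (b w).
have La0 w : 0 < La w := expR_gt0 _.
have A0 w : 0 < A w by rewrite divr_gt0// gauss_lik_gt0.
have B0 w : 0 < B w by rewrite divr_gt0// gauss_lik_gt0.
have uE w : lik u (b w) = La w * A w by rewrite /A /La mulrC divfK// gt_eqF// La0.
have vE w : lik v (b w) = La w * B w by rewrite /B /La mulrC divfK// gt_eqF// La0.
have h2A := hasE_lik_ratio_powR a u 2; have h2B := hasE_lik_ratio_powR a v 2.
have hhA := hasE_lik_ratio_powR a u h; have hhB := hasE_lik_ratio_powR a v h.
have hAB := hasE_lik_ratio_mul a u v.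
set x := vdot (u - a) (u - a) / s ^+ 2 in h2A hhA.
set y := vdot (v - a) (v - a) / s ^+ 2 in h2B hhB.
have x0 : 0 <= x := dot_ge0 _.
have xt : x <= tau := ua; have yt : y <= tau := va; have zt := uv.
have y0 : 0 <= y := dot_ge0 _.
pose z := vdot (u - v) (u - v) / s ^+ 2.
have zE : vdot (u - a) (v - a) / s ^+ 2 = (x + y - z) / 2.
  rewrite /x /y /z -!mulrDl -mulrBl -!mulrA [s ^- 2 / 2]mulrC !mulrA; congr (_ / _).
  rewrite !(vdotDl, vdotDr, vdotNl, vdotNr) (vdotC v u) (vdotC a u) (vdotC a v); by field.
rewrite zE in hAB.
have E2 (t : R) : 2 * (2 - 1) / 2 * t = t by field.
rewrite !E2 in h2A h2B.
have hL := hasE_scale (l * r `^ (l - 1)) (@hasE_add _ _ _ _ _ _ _ _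
  (hasE_scale (1 - q) hFa) (hasE_scale q hFu)).
have hR := hasE_scale ((l - 1) * r `^ l) (@hasE_add _ _ _ _ _ _ _ _
  (hasE_scale (1 - q) hFa') (hasE_scale q hFv')).
have hsq := hasE_add (hasE_add h2A h2B)
  (hasE_scale (- 2) hAB).
have hpw := hasE_add hhA hhB.
(* The linear part of the Taylor bound; its weights 1-q, q-lq and lq sum to 1 and every likelihood
   has mean 1. *)
have hlin := hasE_add (@hasE_add _ _ _ _ _ _ _ _
   (hasE_scale (1 - q) (hasE_lik a)) (hasE_scale (q - l * q) (hasE_lik v)))
   (hasE_scale (l * q) (hasE_lik u)).
have hPsi := hasE_add hlin (hasE_scale coef
   (hasE_add (hasE_scale k1 hsq) (hasE_scale k2 hpw))).
have := hasE_le hL (hasE_add (hasE_scale M hPsi) hR).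
have pt w : l * r `^ (l - 1) * ((1 - q) * (psi (b w) * lik a (b w)) + q * (psi (b w) * lik u (b w))) <=
   M * ((1 - q) * lik a (b w) + (q - l * q) * lik v (b w) + l * q * lik u (b w) +
      coef * (k1 * (lik a (b w) * (lik u (b w) / lik a (b w)) `^ 2 +
                    lik a (b w) * (lik v (b w) / lik a (b w)) `^ 2 +
                    - 2 * (lik a (b w) * (lik u (b w) / lik a (b w)) * (lik v (b w) / lik a (b w)))) +
              k2 * (lik a (b w) * (lik u (b w) / lik a (b w)) `^ h +
                    lik a (b w) * (lik v (b w) / lik a (b w)) `^ h))) +
   (l - 1) * r `^ l * ((1 - q) * (psi' (b w) * lik a (b w)) + q * (psi' (b w) * lik v (b w))).
  rewrite -/(A w) -/(B w) -/(La w) uE vE.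
  pose X := 1 - q + q * A w; pose Y := 1 - q + q * B w.
  have X0 : 0 < X by apply: addr_gt0; [rewrite subr_gt0|exact: mulr_gt0 q0 (A0 w)].
  have Y0 : 0 < Y by apply: addr_gt0; [rewrite subr_gt0|exact: mulr_gt0 q0 (B0 w)].
  have := tangent_rescale r0
    (mulr_gt0 (La0 w) X0) (mulr_gt0 (La0 w) Y0) (pc (b w)).
  have -> : (La w * X) `^ l * (La w * Y) `^ (1 - l) = La w * (X `^ l * Y `^ (1 - l)).
    rewrite !powRM ?(ltW (La0 w)) ?(ltW X0) ?(ltW Y0)// mulrACA; congr (_ * _).
    rewrite -powRD ?(gt_eqF (La0 w)) ?implybT// (_ : l + (1 - l) = 1) ?powRr1 ?(ltW (La0 w))//; by ring.
  have hp := pw (A w) (B w) (A0 w) (B0 w); rewrite -/X -/Y in hp.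
  have hp' : M * (La w * (X `^ l * Y `^ (1 - l))) <= M * (La w * (Y + l * (q * (A w - B w)) +
      coef * (k1 * (A w - B w) ^+ 2 + k2 * (A w `^ h + B w `^ h)))).
    by rewrite ler_wpM2l// ler_pM2l.
  move=> hh; apply: (@le_trans _ _ (l * r `^ (l - 1) * (La w * X * psi (b w)))).
    by apply: eq_le_porder; rewrite /X; move: (r `^ _) => c1; ring.
  apply: le_trans hh _; apply: (@le_trans _ _ (M * (La w * (Y + l * (q * (A w - B w)) +
      coef * (k1 * (A w - B w) ^+ 2 + k2 * (A w `^ h + B w `^ h)))) +
      (l - 1) * r `^ l * (La w * Y * psi' (b w)))); first by rewrite lerD2r.
  apply: eq_le_porder; rewrite !powR_mulrn ?(ltW (A0 w)) ?(ltW (B0 w))// /Y.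
  by move: (_ `^ h) (_ `^ h) (r `^ l) (coef) => c1 c2 c3 c4; ring.
move=> /(_ pt) /le_trans; apply.
rewrite lerD2r ler_wpM2l// !mulr1.
have cross : expR x + expR y - 2 * expR ((x + y - z) / 2) <= 2 * (expR tau - expR (tau / 2)).
  by apply: expR_cross_le; rewrite ?x0 ?y0.
have hh0 : 0 <= h * (h - 1) / 2.
  by rewrite divr_ge0// mulr_ge0 ?subr_ge0// (le_trans ler01).
have hx : h * (h - 1) / 2 * x <= h * (h - 1) / 2 * tau.
  by rewrite ler_wpM2l.
have hy : h * (h - 1) / 2 * y <= h * (h - 1) / 2 * tau.
  by rewrite ler_wpM2l.
rewrite -ler_expR in hx; rewrite -ler_expR in hy.
have br : k1 * (expR x + expR y + - 2 * expR ((x + y - z) / 2)) +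
    k2 * (expR (h * (h - 1) / 2 * x) + expR (h * (h - 1) / 2 * y)) <= 7 * tau * (1 - q).
  have e1 := ler_wpM2l k10 cross; have e2 := ler_wpM2l k20 (lerD hx hy).
  lra.
have := ler_wpM2l coef0 br.
have -> : coef * (7 * tau * (1 - q)) = 7 / 2 * q ^+ 2 * (l * (l - 1)) * tau.
  by rewrite /coef; field; rewrite subr_eq0 eq_sym; apply/eqP => e; move: q1'; rewrite e ltxx.
lra.
Qed.

(** The two components are treated separately: the avoiding one costs nothing, the meeting one costs
    the l-th moment of lik u / lik v. This loses a factor 1/q, affordable since q >= 1/3. *)
Lemma sampled_step_convex : 1 / 3 <= q -> forall r, 0 < r ->
  l * r `^ (l - 1) * ((1 - q) * Fa + q * Fu) <=
  M * (1 + 7 / 2 * q ^+ 2 * (l * (l - 1)) * tau) +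
    (l - 1) * r `^ l * ((1 - q) * Fa' + q * Fv').
Proof.
have l1' : 1 < l := l1; have q0' : 0 < q := q0; have q1' : q < 1 := q1.
move=> q3 r r0.
have p1 w : l * r `^ (l - 1) * (psi (b w) * lik a (b w)) <=
    M * lik a (b w) + (l - 1) * r `^ l * (psi' (b w) * lik a (b w)).
  have := tangent_rescale r0 (gauss_lik_gt0 a (b w)) (gauss_lik_gt0 a (b w)) (@pc (b w)).
  rewrite -powRD ?(gt_eqF (gauss_lik_gt0 a (b w))) ?implybT//.
  by rewrite (_ : l + (1 - l) = 1) ?powRr1 ?(ltW (gauss_lik_gt0 a (b w))) ?(mulrC (psi _)) ?(mulrC (psi' _))//; lra.
have p2 w : l * r `^ (l - 1) * (psi (b w) * lik u (b w)) <=
    M * (lik v (b w) * (lik u (b w) / lik v (b w)) `^ l) + (l - 1) * r `^ l * (psi' (b w) * lik v (b w)).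
  have := tangent_rescale r0 (gauss_lik_gt0 u (b w)) (gauss_lik_gt0 v (b w)) (@pc (b w)).
  suff -> : lik u (b w) `^ l * lik v (b w) `^ (1 - l) = lik v (b w) * (lik u (b w) / lik v (b w)) `^ l.
    by rewrite (mulrC (psi _)) (mulrC (psi' _)).
  rewrite /gauss_lik -expRN -!expRM -!expRD -expRM -expRD; congr expR; by field.
have h1 := hasE_le (hasE_scale (l * r `^ (l - 1)) hFa)
  (hasE_add (hasE_scale M (hasE_lik a)) (hasE_scale ((l - 1) * r `^ l) hFa')) p1.
have h2 := hasE_le (hasE_scale (l * r `^ (l - 1)) hFu)
  (hasE_add (hasE_scale M (hasE_lik_ratio_powR v u l)) (hasE_scale ((l - 1) * r `^ l) hFv')) p2.
have num := expR_sub1_le_sampled _ tau q l tauP q3 l1 hyp.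
set e := expR _ in h2; set E := expR _ in num.
have eE : e <= E.
  by rewrite ler_expR ler_wpM2l// divr_ge0// mulr_ge0; lra.
have k1 : (1 - q) * (l * r `^ (l - 1) * Fa) <= (1 - q) * (M * 1 + (l - 1) * r `^ l * Fa').
  by rewrite ler_wpM2l//; lra.
have k2 : q * (l * r `^ (l - 1) * Fu) <= q * (M * e + (l - 1) * r `^ l * Fv').
  by rewrite ler_wpM2l//; lra.
have k3 : M * (q * (e - 1)) <= M * (7 / 2 * q ^+ 2 * (l * (l - 1)) * tau).
  rewrite ler_wpM2l//; apply: le_trans num; rewrite ler_wpM2l//; lra.
lra.
Qed.

Lemma sampled_step : forall r, 0 < r ->
  l * r `^ (l - 1) * ((1 - q) * Fa + q * Fu) <=
  M * (1 + 7 / 2 * q ^+ 2 * (l * (l - 1)) * tau) +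
    (l - 1) * r `^ l * ((1 - q) * Fa' + q * Fv').
Proof.
by have [/sampled_step_mixture//|/ltW/sampled_step_convex] := leP q (1 / 3).
Qed.

End sampled_step.

(** * The chain of iterates *)

Section chain.
Context d (Omega : measurableType d) (R : realType) (P : probability Omega R).
Context (dim n : nat) (IJ : nat -> Omega -> 'I_n * 'I_n) (B : nat -> 'I_dim -> Omega -> R).
Local Notation V := (@rVT R dim).
Hypothesis mIJ : forall t p, measurable (IJ t @^-1` [set p]).
Hypothesis mB : forall t k, measurable_fun setT (B t k).
Hypothesis indep : mutually_independent P (alg2_classes IJ B).
Variables (proj : V -> V) (eta : nat -> R).
Hypothesis mproj : measurable_fun setT proj.

Definition noise t (w : Omega) : V := \row_i B t i w.

Definition chain_step (g : 'I_n * 'I_n -> V -> V) (k : nat) (p : 'I_n * 'I_n)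
    (z : (V * V) * V) : V * V :=
  let v := proj (z.1.1 - eta k *: (g p z.1.1 + z.2)) in (v, z.1.2 + v).

(* The second component accumulates the sum of the iterates, so that the averaged
   output is a function of the current state. *)
Fixpoint chain (g : 'I_n * 'I_n -> V -> V) (k : nat) (w : Omega) : V * V :=
  if k is k'.+1 then chain_step g k (IJ k w) (chain g k' w, noise k w) else (0, 0).

Definition index_time (i : nat + (nat * 'I_dim)) : nat :=
  match i with inl t => t | inr tk => tk.1 end.

Lemma measurable_noise_t t : measurable_fun setT (noise t).
Proof. exact: measurable_noise. Qed.

Lemma measurable_class i A : alg2_classes IJ B i A -> measurable A.
Proof.
case: i => [t|[t k]] /=; last by move=> [C mC <-]; have := mB t k measurableT mC; rewrite setTI.
move=> [C _ <-].
have -> : IJ t @^-1` C = \bigcup_(p in [set: 'I_n * 'I_n])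
    (if `[< C p >] then IJ t @^-1` [set p] else set0).
  apply/seteqP; split=> [w Cw|w [p _ /=]].
    by exists (IJ t w) => //=; case: asboolP.
  by case: asboolP => // Cp /= wp; rewrite /preimage /= wp.
by apply: fin_bigcup_measurable => // p _; case: ifP.
Qed.

Lemma measurable_big_class s (E : nat + (nat * 'I_dim) -> set Omega) :
  (forall i, i \in s -> alg2_classes IJ B i (E i)) ->
  measurable (\big[setI/setT]_(i <- s) E i).
Proof.
move=> H; rewrite big_seq; elim/big_rec: _ => // i A si mA.
by apply: measurableI => //; apply: (@measurable_class i); exact: H.
Qed.

Section one_chain.
Variable g : 'I_n * 'I_n -> V -> V.
Hypothesis mg : forall p, measurable_fun setT (g p).

Lemma measurable_chain_step k p : measurable_fun setT (chain_step g k p).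
Proof.
have m1 : measurable_fun setT (fun z : (V * V) * V => z.1.1).
  exact: (measurableT_comp measurable_fst measurable_fst).
have m2 : measurable_fun setT (fun z : (V * V) * V => z.1.2).
  exact: (measurableT_comp measurable_snd measurable_fst).
have co (h : (V * V) * V -> V) i : measurable_fun setT h ->
    measurable_fun setT (fun z => h z ord0 i).
  by move=> mh; exact: (measurableT_comp (measurable_coord i) mh).
have mv : measurable_fun setT (fun z : (V * V) * V => proj (z.1.1 - eta k *: (g p z.1.1 + z.2))).
  apply: (measurableT_comp mproj); apply: measurable_fun_rV => i.
  under eq_fun do rewrite !mxE.
  apply: measurable_funB; first exact: co.
  apply: measurable_funM => //; apply: measurable_funD.
    by apply: (co (fun z => g p z.1.1)) => //; exact: (measurableT_comp (mg p) m1).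
  exact: (co snd).
apply: measurable_fun_pair => //; apply: measurable_fun_rV => i.
under eq_fun do rewrite !mxE.
by apply: measurable_funD; [exact: co|exact: (co (fun z => proj _))].
Qed.

Lemma chain_partition k (A : set (V * V)) :
  chain g k.+1 @^-1` A = \bigcup_(p in [set: 'I_n * 'I_n])
    (((fun w => chain_step g k.+1 p (chain g k w, noise k.+1 w)) @^-1` A) `&` (IJ k.+1 @^-1` [set p])).
Proof.
apply/seteqP; split=> [w Aw|w [p _ [/= Aw pw]]]; first by exists (IJ k.+1 w).
by rewrite /preimage /= pw.
Qed.

Lemma measurable_chain k : measurable_fun setT (chain g k).
Proof.
elim: k => [|k IH]; first exact: measurable_cst.
move=> _ A mA; rewrite setTI chain_partition.
apply: fin_bigcup_measurable => // p _; apply: measurableI => //.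
have mc : measurable_fun setT (fun w => chain_step g k.+1 p (chain g k w, noise k.+1 w)).
  apply: (measurableT_comp (measurable_chain_step k.+1 p)).
  by apply: measurable_fun_pair => //; exact: measurable_noise_t.
by have := mc measurableT _ mA; rewrite setTI.
Qed.

Let prodP (E : nat + (nat * 'I_dim) -> set Omega) s := \prod_(i <- s) fine (P (E i)).

Let prodP_ge0 E s : 0 <= prodP E s.
Proof. by apply: prodr_ge0 => i _; exact: fine_ge0. Qed.

(* Independence of the chain from finite intersections of later events; the
   induction on k needs arbitrary future events, not only those of time k.+1. *)
Definition indep_future k := forall A s E, measurable A -> uniq s ->
  (forall i, i \in s -> alg2_classes IJ B i (E i)) ->
  (forall i, i \in s -> (k < index_time i)%N) ->
  (P (chain g k @^-1` A `&` \big[setI/setT]_(i <- s) E i) =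
   P (chain g k @^-1` A) * (prodP E s)%:E)%E.

(** On the event that step k.+1 samples p and given later events hold, the state and the noise of
    that step are independent. A box for the noise is a finite intersection of coordinate events of
    time k.+1, so it joins the pair and the later events in one list of events in the future of
    k. *)
Lemma chain_noise_integral k p s E (F : (V * V) * V -> \bar R) : indep_future k ->
  uniq s -> (forall i, i \in s -> alg2_classes IJ B i (E i)) ->
  (forall i, i \in s -> (k.+1 < index_time i)%N) ->
  measurable_fun setT F -> (forall x, 0 <= F x)%E ->
  (\int[P]_w (F (chain g k w, noise k.+1 w) *
      (\1_(IJ k.+1 @^-1` [set p] `&` \big[setI/setT]_(i <- s) E i) w)%:E) =
   (fine (P (IJ k.+1 @^-1` [set p])) * prodP E s)%:E *
     \int[P]_w \int[P]_w' F (chain g k w, noise k.+1 w'))%E.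
Proof.
move=> IH us clE tE mF F0.
have mE := measurable_big_class clE.
have mD : measurable (IJ k.+1 @^-1` [set p] `&` \big[setI/setT]_(i <- s) E i) by exact: measurableI.
apply: integral_indep => //.
- exact: measurable_chain.
- exact: measurable_noise_t.
- by rewrite mulr_ge0// fine_ge0.
move=> A C mA mC; set D := _ `&` \big[_/_]_(_ <- _) _; set c := fine _ * _.
have mcA : measurable (chain g k @^-1` A) by have := measurable_chain k measurableT mA; rewrite setTI.
have PAE : P (chain g k @^-1` A) = (fine (P (chain g k @^-1` A)))%:E by rewrite fineK// fin_num_measure.
rewrite muleA {1}PAE -EFinM.
rewrite (_ : _ `&` _ `&` D = noise k.+1 @^-1` C `&` (chain g k @^-1` A `&` D)); last first.
  by rewrite setIA (setIC (noise _ @^-1` _)).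
have c0 : 0 <= c * fine (P (chain g k @^-1` A)) by rewrite !mulr_ge0// fine_ge0.
apply: (indep_generated _ _ _ P _ _ (@rV_boxes R dim)) => //.
- exact: measurable_noise_t.
- exact: measurableI.
- exact: rV_boxes_generate.
- exact: rV_boxes_setI.
- exact: rV_boxes_setT.
move=> _ [A' [mA' ->]].
pose nz := [seq inr (k.+1, i) : nat + (nat * 'I_dim) | i <- enum 'I_dim].
(* At time k.+1 the events are those of the sampled pair and of the box; s only holds later indices,
   where E is kept. *)
pose E' (j : nat + (nat * 'I_dim)) := match j with
  | inl t => if t == k.+1 then IJ t @^-1` [set p] else E j
  | inr ti => if ti.1 == k.+1 then B ti.1 ti.2 @^-1` A' ti.2 else E j end.
have E's i : i \in s -> E' i = E i.
  by move=> /tE; rewrite /E'; case: i => [t|[t j]] /=; case: eqP => // ->; rewrite ltnn.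
have unz : uniq nz by rewrite map_inj_uniq ?enum_uniq// => i j [].
have clnz i : i \in nz -> alg2_classes IJ B i (E' i).
  by move=> /mapP[j _ ->]; rewrite /E' /= eqxx; exists (A' j).
have bign (X : nat + (nat * 'I_dim) -> set Omega) : \big[setI/setT]_(i <- nz) X i =
    [set w | forall i, X (inr (k.+1, i)) w].
  rewrite /nz big_map -bigcap_seq; apply/seteqP; split=> w /= h i => [|_]; last exact: h.
  by apply: h; rewrite /= mem_enum.
have boxE : noise k.+1 @^-1` [set v : V | forall i, A' i (v ord0 i)] = \big[setI/setT]_(i <- nz) E' i.
  rewrite bign; apply/seteqP; split=> w /= h i; have := h i; rewrite /E' /= eqxx /=; rewrite mxE//.
have Pbox : P (\big[setI/setT]_(i <- nz) E' i) = (prodP E' nz)%:E by exact: indep.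
have us' : uniq (nz ++ inl k.+1 :: s).
  rewrite cat_uniq unz /= us andbT negb_or -andbA; apply/and3P; split.
  - by apply/negP => /mapP[].
  - apply/hasPn => i /tE it; apply/negP => /mapP[j _ ij].
    by move: it; rewrite ij /= ltnn.
  - by apply/negP => /tE /=; rewrite ltnn.
have cl' i : i \in nz ++ inl k.+1 :: s -> alg2_classes IJ B i (E' i).
  rewrite mem_cat inE => /or3P[/clnz//|/eqP ->|si]; first by rewrite /E' eqxx; exists [set p].
  by rewrite E's//; exact: clE.
have t' i : i \in nz ++ inl k.+1 :: s -> (k < index_time i)%N.
  by rewrite mem_cat inE => /or3P[/mapP[j _ ->]|/eqP ->|/tE/ltnW].
have := IH A (nz ++ inl k.+1 :: s) E' mA us' cl' t'.
have -> : \big[setI/setT]_(i <- nz ++ inl k.+1 :: s) E' i =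
    (\big[setI/setT]_(i <- nz) E' i) `&` D.
  rewrite big_cat big_cons /= eqxx /D; congr (_ `&` (_ `&` _)).
  by apply: eq_big_seq => i si; rewrite E's.
have -> : prodP E' (nz ++ inl k.+1 :: s) = prodP E' nz * c.
  rewrite /prodP big_cat big_cons /= eqxx /c; congr (_ * (_ * _)).
  by apply: eq_big_seq => i si; rewrite E's.
rewrite boxE Pbox PAE => h.
by rewrite setIC -setIA (setIC D) h -!EFinM; congr EFin; ring.
Qed.

(** Splitting over the value of the next sampled pair, [key] writes the probability as the product
    over the later events times a sum that does not depend on them. *)
Lemma chain_indep_future k : indep_future k.
Proof.
elim: k => [|k IH] A s E mA us clE tE.
  have [A0|A0] := pselect (A (0, 0)).
    rewrite (_ : chain g 0 @^-1` A = setT) ?setTI ?probability_setT ?mul1e; last first.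
      by apply/seteqP; split.
    exact: indep.
  rewrite (_ : chain g 0 @^-1` A = set0) ?set0I ?measure0 ?mul0e//.
  by apply/seteqP; split.
pose Q p : set ((V * V) * V) := chain_step g k.+1 p @^-1` A.
have mQ p : measurable (Q p).
  by have := @measurable_chain_step k.+1 p measurableT _ mA; rewrite setTI.
pose F p z : \bar R := (\1_(Q p) z)%:E.
have mF p : measurable_fun setT (F p).
  by apply/measurable_EFinP; exact: measurable_indic.
have F0 p z : (0 <= F p z)%E by rewrite lee_fin.
have mcA : measurable (chain g k.+1 @^-1` A).
  by have := @measurable_chain k.+1 measurableT _ mA; rewrite setTI.
have key s' E' : uniq s' -> (forall i, i \in s' -> alg2_classes IJ B i (E' i)) ->
    (forall i, i \in s' -> (k.+1 < index_time i)%N) ->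
    (P (chain g k.+1 @^-1` A `&` \big[setI/setT]_(i <- s') E' i) =
     (prodP E' s')%:E * \sum_p (fine (P (IJ k.+1 @^-1` [set p])))%:E *
        \int[P]_w \int[P]_w' F p (chain g k w, noise k.+1 w'))%E.
  move=> us' cl' t'.
  rewrite ge0_sume_distrr; last first.
    move=> p _; rewrite mule_ge0 ?lee_fin ?fine_ge0//.
    by apply: integral_ge0 => w _; apply: integral_ge0.
  rewrite -[X in P X]setIT -integral_indic; last first.
  - by apply: measurableI => //; exact: measurable_big_class.
  - exact: measurableT.
  transitivity (\int[P]_w (\sum_p (F p (chain g k w, noise k.+1 w) *
      (\1_(IJ k.+1 @^-1` [set p] `&` \big[setI/setT]_(i <- s') E' i) w)%:E)))%E.
    apply: eq_integral => w _.
    pose D p := IJ k.+1 @^-1` [set p] `&` \big[setI/setT]_(i <- s') E' i.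
    have D0 p : p != IJ k.+1 w -> \1_(D p) w = 0 :> R.
      by move=> pw; rewrite indicE memNset// => -[/= e _]; rewrite e eqxx in pw.
    have D1 : \1_(chain g k.+1 @^-1` A `&` \big[setI/setT]_(i <- s') E' i) w =
        \1_(Q (IJ k.+1 w)) (chain g k w, noise k.+1 w) * \1_(D (IJ k.+1 w)) w :> R.
      rewrite !indicE -natrM mulnb; congr (_%:R); congr nat_of_bool.
      apply/idP/andP; rewrite !inE /Q /D /=; first by move=> [].
      by move=> [h [_ h']]; split.
    rewrite D1 (bigD1 (IJ k.+1 w))//= [X in (_ + X)%E]big1 ?adde0//.
    by move=> p pw; rewrite -/(D p) D0// mule0.
  rewrite ge0_integral_sum//; last 2 first.
  - move=> p; apply: emeasurable_funM.
      apply: (measurableT_comp (mF p)); apply: measurable_fun_pair.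
        exact: measurable_chain.
      exact: measurable_noise_t.
    apply/measurable_EFinP; apply: measurable_indic; apply: measurableI => //.
    exact: measurable_big_class.
  - by move=> p w _; rewrite mule_ge0// lee_fin.
  apply: eq_bigr => p _; rewrite (chain_noise_integral p IH us' cl' t' (mF p) (F0 p)).
  by rewrite EFinM [(_%:E * (prodP _ _)%:E)%E]muleC -muleA.
rewrite key// [RHS]muleC; congr (_ * _)%E.
(* The empty list of later events identifies that sum with the probability of A under the chain. *)
have := key [::] E isT; rewrite big_nil setIT /prodP big_nil mul1e => ->//.
Qed.

Variables (wt : 'I_n * 'I_n -> R).
Hypothesis wtP : forall t p, P (IJ t @^-1` [set p]) = (wt p)%:E.

(** The Markov operator of one step acting on test functions. *)
Definition kernel_step k (phi : V * V -> R) (x : V * V) : R :=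
  \sum_p wt p * fine (\int[P]_w (phi (chain_step g k p (x, noise k w)))%:E)%E.

Lemma wt_ge0 p : 0 <= wt p.
Proof. by rewrite -lee_fin -(wtP 0). Qed.

Section kernel.
Variables (k : nat) (phi : V * V -> R).
Hypothesis mphi : measurable_fun setT phi.
Hypothesis phi01 : forall x, 0 <= phi x <= 1.

Lemma measurable_step_noise p x : measurable_fun setT (fun w => phi (chain_step g k p (x, noise k w))).
Proof.
apply: (measurableT_comp mphi); apply: (measurableT_comp (measurable_chain_step k p)).
by apply: measurable_fun_pair => //; exact: measurable_noise_t.
Qed.

Lemma integral_step_bounds p x :
  (0 <= \int[P]_w (phi (chain_step g k p (x, noise k w)))%:E <= 1)%E.
Proof.
apply/andP; split.
  by apply: integral_ge0 => w _; rewrite lee_fin; case/andP: (phi01 (chain_step g k p (x, noise k w))).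
apply: (@le_trans _ _ (\int[P]_w cst 1 w)%E).
  apply: ge0_le_integral => //.
  - by move=> w _; rewrite lee_fin; case/andP: (phi01 (chain_step g k p (x, noise k w))).
  - by apply/measurable_EFinP; exact: measurable_step_noise.
  - by move=> w _; rewrite lee_fin; case/andP: (phi01 (chain_step g k p (x, noise k w))).
by rewrite integral_cst// mul1e; exact: probability_le1.
Qed.

Lemma step_fineK p x :
  ((fine (\int[P]_w (phi (chain_step g k p (x, noise k w)))%:E))%:E =
   \int[P]_w (phi (chain_step g k p (x, noise k w)))%:E)%E.
Proof.
have /andP[h0 h1] := integral_step_bounds p x.
by rewrite fineK// ge0_fin_numE// (le_lt_trans h1)// ltry.
Qed.

Lemma measurable_kernel_step : measurable_fun setT (kernel_step k phi).
Proof.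
apply: measurable_sum => p; apply: measurable_funM => //.
have mF : measurable_fun setT (fun z : (V * V) * Omega => (phi (chain_step g k p (z.1, noise k z.2)))%:E).
  apply/measurable_EFinP; apply: (measurableT_comp mphi).
  apply: (measurableT_comp (measurable_chain_step k p)).
  apply: measurable_fun_pair => //; apply: (measurableT_comp (measurable_noise_t k)).
  exact: measurable_snd.
have := @measurable_fun_fubini_tonelli_F _ _ _ _ _ P _ mF.
move=> /(_ (fun z => _)); rewrite /fubini_F /= => h.
apply: (measurableT_comp (@fine_measurable R setT measurableT)).
by apply: h => z; rewrite lee_fin; case/andP: (phi01 (chain_step g k p (z.1, noise k z.2))).
Qed.

Lemma kernel_step_bounds x : \sum_p wt p = 1 -> 0 <= kernel_step k phi x <= 1.
Proof.
move=> wt1; have bnd p : 0 <= fine (\int[P]_w (phi (chain_step g k p (x, noise k w)))%:E)%E <= 1.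
  by rewrite -!lee_fin step_fineK; exact: integral_step_bounds.
apply/andP; split.
  by apply: sumr_ge0 => p _; rewrite mulr_ge0 ?wt_ge0//; case/andP: (bnd p).
rewrite -wt1; apply: ler_sum => p _; rewrite -[leRHS]mulr1 ler_wpM2l ?wt_ge0//.
by case/andP: (bnd p).
Qed.

End kernel.

Lemma chain_kernel k (phi : V * V -> R) : measurable_fun setT phi ->
  (forall x, 0 <= phi x <= 1) ->
  (\int[P]_w (phi (chain g k.+1 w))%:E = \int[P]_w (kernel_step k.+1 phi (chain g k w))%:E)%E.
Proof.
move=> mphi phi01.
have phi0 x : 0 <= phi x by case/andP: (phi01 x).
pose F p z : \bar R := (phi (chain_step g k.+1 p z))%:E.
have mF p : measurable_fun setT (F p).
  by apply/measurable_EFinP; apply: (measurableT_comp mphi); exact: measurable_chain_step.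
have F0 p z : (0 <= F p z)%E by rewrite lee_fin.
have mcF p : measurable_fun setT (fun w => F p (chain g k w, noise k.+1 w)).
  apply: (measurableT_comp (mF p)); apply: measurable_fun_pair.
    exact: measurable_chain.
  exact: measurable_noise_t.
transitivity (\int[P]_w (\sum_p (F p (chain g k w, noise k.+1 w) *
    (\1_(IJ k.+1 @^-1` [set p]) w)%:E)))%E.
  apply: eq_integral => w _; rewrite (bigD1 (IJ k.+1 w))//= [X in (_ + X)%E]big1 ?adde0.
    by rewrite indicE mem_set// mule1.
  move=> p pw; rewrite indicE memNset ?mule0//= => e.
  by rewrite e eqxx in pw.
rewrite ge0_integral_sum//; last 2 first.
- move=> p; apply: emeasurable_funM; first exact: mcF.
  by apply/measurable_EFinP; apply: measurable_indic; exact: mIJ.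
- by move=> p w _; rewrite mule_ge0// lee_fin.
transitivity (\sum_p (wt p)%:E * \int[P]_w \int[P]_w' F p (chain g k w, noise k.+1 w'))%E.
  apply: eq_bigr => p _.
  have := @chain_noise_integral k p [::] (fun=> setT) (F p) (chain_indep_future (k := k)) isT _ _ (mF p) (F0 p).
  rewrite big_nil setIT /prodP big_nil mulr1 wtP => -> //.
have mI p : measurable_fun setT (fun w => (\int[P]_w' F p (chain g k w, noise k.+1 w'))%E).
  have mF' : measurable_fun setT (fun z : (V * V) * Omega => F p (z.1, noise k.+1 z.2)).
    apply: (measurableT_comp (mF p)); apply: measurable_fun_pair => //.
    by apply: (measurableT_comp (measurable_noise_t k.+1)); exact: measurable_snd.
  have := @measurable_fun_fubini_tonelli_F _ _ _ _ _ P _ mF' (fun=> F0 _ _).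
  by move=> h; exact: (measurableT_comp h (measurable_chain k)).
have I0 p w : (0 <= \int[P]_w' F p (chain g k w, noise k.+1 w'))%E by exact: integral_ge0.
under eq_bigr do rewrite -ge0_integralZl_EFin ?wt_ge0//.
rewrite -ge0_integral_sum//; last 2 first.
- by move=> p; exact: measurable_funeM.
- by move=> p w _; rewrite mule_ge0// lee_fin wt_ge0.
apply: eq_integral => w _; rewrite /kernel_step -sumEFin; apply: eq_bigr => p _.
by rewrite EFinM step_fineK.
Qed.

End one_chain.
End chain.

(** * Privacy of the chain *)

(* The uniform law on off-diagonal pairs is the mixture, of weights 1 - 2/n and 2/n,
   of the uniform laws on the pairs avoiding i0 and on those meeting i0; the two are
   coupled independently. *)
Lemma offdiag_average (R : realType) (n : nat) (i0 : 'I_n) (D : 'I_n * 'I_n -> R) (K : R) :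
  (2 < n)%N ->
  (forall a u : 'I_n * 'I_n, a.1 != i0 -> a.2 != i0 -> (u.1 == i0) || (u.2 == i0) ->
     (1 - 2 / n%:R) * D a + 2 / n%:R * D u <= K) ->
  \sum_p (if p.1 != p.2 then (n * n.-1)%:R^-1 else 0) * D p <= K.
Proof.
move=> n2 H.
pose offd (p : 'I_n * 'I_n) := p.1 != p.2.
pose hit (p : 'I_n * 'I_n) := (p.1 == i0) || (p.2 == i0).
pose S (Q : pred ('I_n * 'I_n)) : R := \sum_(p | offd p && Q p) D p.
pose c (Q : pred ('I_n * 'I_n)) : R := \sum_(p | offd p && Q p) 1.
have n0 : 0 < n%:R :> R by rewrite ltr0n (leq_trans _ n2).
have nE : n.-1%:R = n%:R - 1 :> R.
  by rewrite -subn1 natrB// (leq_trans _ n2).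
have cT : \sum_(p : 'I_n * 'I_n | offd p) 1 = n%:R * (n%:R - 1) :> R.
  rewrite -(pair_big_dep xpredT (fun i j => i != j) (fun _ _ => 1))/=.
  rewrite (eq_bigr (fun=> n.-1%:R)); last first.
    move=> i _; rewrite (eq_bigl (predC1 i)) ?sumr_const ?cardC1 ?card_ord// => j.
    by rewrite !inE eq_sym.
  by rewrite sumr_const card_ord -nE mulr_natl.
have cC : c hit = 2 * (n%:R - 1).
  rewrite /c -(pair_big_dep xpredT (fun i j => (i != j) && ((i == i0) || (j == i0))) (fun _ _ => 1))/=.
  rewrite (bigD1 i0)//= (eq_bigl (predC1 i0)); last by move=> j; rewrite !inE eqxx andbT eq_sym.
  rewrite sumr_const cardC1 card_ord.
  rewrite (eq_bigr (fun=> 1)); last first.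
    move=> i ii0; rewrite (eq_bigl (pred1 i0)) ?big_pred1_eq// => j.
    rewrite !inE (negbTE ii0) /=; case: (j =P i0) => [->|_]; last by rewrite andbF.
    by rewrite ii0.
  by rewrite (eq_bigl (predC1 i0))// sumr_const cardC1 card_ord nE; ring.
have cN : c (predC hit) = (n%:R - 1) * (n%:R - 2).
  have := cT; rewrite (bigID hit)/= -/(c hit) cC /c => h.
  by rewrite -[LHS](addKr (2 * (n%:R - 1))) h; ring.
have LE : \sum_p (if p.1 != p.2 then (n * n.-1)%:R^-1 else 0) * D p =
    (n%:R * (n%:R - 1))^-1 * (S hit + S (predC hit)).
  rewrite /S -(bigID hit offd D) mulr_sumr [RHS]big_mkcond; apply: eq_bigr => p _.
  by rewrite /offd natrM nE; case: ifP => _ //; rewrite mul0r.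
rewrite LE.
have n21 : 2 < n%:R :> R by rewrite ltr_nat.
have nn0 : 0 < n%:R * (n%:R - 1) :> R by rewrite mulr_gt0//; lra.
rewrite mulrC ler_pdivrMr//.
(* There are (n-1)(n-2) avoiding and 2(n-1) meeting pairs, so in the double sum D a and D u both
   receive the weight 2(n-1)(n-2)/n, and the two partial sums recombine into the full one. *)
have key : \sum_(a | offd a && predC hit a) \sum_(u | offd u && hit u)
      ((1 - 2 / n%:R) * D a + 2 / n%:R * D u) <=
    \sum_(a | offd a && predC hit a) \sum_(u | offd u && hit u) K.
  apply: ler_sum => a /andP[_ /norP[a1 a2]]; apply: ler_sum => u /andP[_ hu].
  exact: H.
have K1 (Q : pred ('I_n * 'I_n)) (x : R) : \sum_(p | offd p && Q p) x = c Q * x.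
  by rewrite /c mulr_suml; apply: eq_bigr => p _; rewrite mul1r.
rewrite K1 K1 in key.
have KL : \sum_(a | offd a && predC hit a) \sum_(u | offd u && hit u)
      ((1 - 2 / n%:R) * D a + 2 / n%:R * D u) =
   c hit * (1 - 2 / n%:R) * S (predC hit) + c (predC hit) * (2 / n%:R) * S hit.
  under eq_bigr do rewrite big_split /= K1 -mulr_sumr -/(S hit).
  by rewrite big_split /= K1 /S -!mulr_sumr !mulrA.
rewrite KL cC cN in key.
have n20 : 0 < 2 * (n%:R - 1) * (n%:R - 2) / n%:R :> R.
  by rewrite divr_gt0// !mulr_gt0//; lra.
rewrite -(ler_pM2l n20).
have nz : n%:R != 0 :> R by rewrite gt_eqF.
have -> : 2 * (n%:R - 1) * (n%:R - 2) / n%:R * (K * (n%:R * (n%:R - 1))) =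
   (n%:R - 1) * (n%:R - 2) * (2 * (n%:R - 1) * K) by field.
apply: le_trans key; apply: eq_le_porder.
by move: (S hit) (S _) => x y; field.
Qed.

(** After division by l r^(l-1) this r gives m' the coefficient exp eps, and since r >= exp eps and
    l >= 1 the constant is at most A exp(-eps (l-1)). *)
Lemma dp_of_moment (R : realType) (l eps A m m' del : R) : 1 < l -> 0 <= A ->
  A * expR (- (eps * (l - 1))) <= del ->
  (forall r, 0 < r -> l * r `^ (l - 1) * m <= A + (l - 1) * r `^ l * m') ->
  m <= expR eps * m' + del.
Proof.
move=> l1 A0 Ad H.
have l0 : 0 < l by lra.
have l10 : 0 < l - 1 by lra.
pose r := expR eps * (l / (l - 1)).
have k1 : 1 <= l / (l - 1) by rewrite ler_pdivlMr// mul1r; lra.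
have r0 : 0 < r by rewrite mulr_gt0 ?expR_gt0// divr_gt0.
have rp : 0 < r `^ (l - 1) by exact: powR_gt0.
have rl : r `^ l = r * r `^ (l - 1) by rewrite mulr_powRB1// ltW.
have rE : (l - 1) * r = l * expR eps.
  by rewrite /r; field; rewrite gt_eqF.
have big : expR (eps * (l - 1)) <= r `^ (l - 1).
  rewrite expRM; apply: ge0_ler_powR; rewrite ?nnegrE ?expR_ge0 ?(ltW r0) ?(ltW l10)//.
  by rewrite /r ler_peMr ?expR_ge0.
have h1 : A <= del * r `^ (l - 1).
  apply: (@le_trans _ _ (A * expR (- (eps * (l - 1))) * expR (eps * (l - 1)))).
    by rewrite -mulrA -expRD addNr expR0 mulr1.
  by apply: ler_pM => //; rewrite ?expR_ge0// mulr_ge0// expR_ge0.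
have h2 : A <= l * r `^ (l - 1) * del.
  have d0 : 0 <= del by rewrite (le_trans _ Ad)// mulr_ge0 ?expR_ge0.
  have : 1 * (del * r `^ (l - 1)) <= l * (del * r `^ (l - 1)).
    by rewrite ler_wpM2r ?mulr_ge0 ?(ltW rp)//; lra.
  lra.
have := H _ r0; rewrite rl [(l - 1) * _]mulrA rE => h3.
rewrite -(ler_pM2l (mulr_gt0 l0 rp)); apply: le_trans h3 _.
by move: (expR eps) (r `^ _) h2 => e c h2; lra.
Qed.

Section privacy.
Context d (Omega : measurableType d) (R : realType) (P : probability Omega R).
Context (dim n : nat) (IJ : nat -> Omega -> 'I_n * 'I_n) (B : nat -> 'I_dim -> Omega -> R).
Local Notation V := (@rVT R dim).
Hypothesis mIJ : forall t p, measurable (IJ t @^-1` [set p]).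
Hypothesis mB : forall t k, measurable_fun setT (B t k).
Hypothesis indep : mutually_independent P (alg2_classes IJ B).
Variable s : R.
Hypothesis s0 : s != 0.
Hypothesis lawB : forall t k A, measurable A -> P (B t k @^-1` A) = normal_prob 0 s A.
Variables (proj : V -> V) (eta : nat -> R) (W : set V).
Hypothesis mproj : measurable_fun setT proj.
Hypothesis projW : forall x, W (proj x).
Hypothesis W0 : W 0.
Let wt (p : 'I_n * 'I_n) : R := if p.1 != p.2 then (n * n.-1)%:R^-1 else 0.
Hypothesis wtP : forall t p, P (IJ t @^-1` [set p]) = (wt p)%:E.
Local Notation chain := (chain IJ B proj eta).
Local Notation step := (chain_step proj eta).
Local Notation ker g := (kernel_step P B proj eta g wt).

Lemma noise_box t (A : 'I_dim -> set R) : (forall i, measurable (A i)) ->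
  P [set w | forall i, A i (B t i w)] = (\prod_i fine (P (B t i @^-1` A i)))%:E.
Proof.
move=> mA; pose E (j : nat + (nat * 'I_dim)) :=
  match j with inl _ => setT | inr ti => B ti.1 ti.2 @^-1` A ti.2 end.
pose nz := [seq inr (t, i) : nat + (nat * 'I_dim) | i <- index_enum 'I_dim].
have h : P (\big[setI/setT]_(k <- nz) E k) = (\prod_(k <- nz) fine (P (E k)))%:E.
  apply: indep; first by rewrite map_inj_uniq ?index_enum_uniq// => i j [].
  by move=> j /mapP[i _ ->]; rewrite /E /=; exists (A i) => //; exact: mA.
rewrite !big_map -bigcap_seq in h; rewrite -h; congr (P _).
apply/seteqP; split=> w /= Aw i; first by move=> _; exact: Aw.
by apply: (Aw i); rewrite /= mem_index_enum.
Qed.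

Lemma noise_mgf t u : hasE P (fun w => expR (vdot u (noise B t w) / s ^+ 2))
  (expR (vdot u u / 2 / s ^+ 2)).
Proof.
apply: hasE_ge0.
- by move=> w; exact: expR_ge0.
- apply: (measurableT_comp (@measurable_expR R)); apply: measurable_funM => //.
  by apply: (measurableT_comp (measurable_vdot R dim u)); exact: measurable_noise_t.
- exact: (gauss_mgf _ _ _ P _ (B t) s s0 (mB t) (lawB t) (fun A => @noise_box t A)).
Qed.

Lemma wt_sum1 : \sum_p wt p = 1.
Proof.
have : (\sum_p P (IJ 0 @^-1` [set p]) = 1)%E.
  rewrite -(@probability_setT _ _ _ P).
  have -> : [set: Omega] = \big[setU/set0]_(p : 'I_n * 'I_n) (IJ 0 @^-1` [set p]).
    by rewrite -bigcup_seq; apply/seteqP; split=> w //= _; exists (IJ 0 w) => //=; rewrite mem_index_enum.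
  rewrite -bigcup_seq measure_fin_bigcup//.
  - by rewrite -fsbig_seq// index_enum_uniq.
  - by move=> p p' _ _ [w [/= <- <-]].
by under eq_bigr do rewrite wtP; rewrite sumEFin => -[].
Qed.

(** With zero gradient, the true step is the unshifted one evaluated at noise plus gradient: all
    pairs and both datasets then share one map, and the gradient enters only through a
    likelihood. *)
Let noshift (p : 'I_n * 'I_n) (x : V) : V := 0.

Section one_step.
Variables (g : 'I_n * 'I_n -> V -> V) (k : nat) (phi : V * V -> R).
Hypothesis mg : forall p, measurable_fun setT (g p).
Hypothesis mphi : measurable_fun setT phi.
Hypothesis phi01 : forall x : V * V, 0 <= phi x <= 1.

Lemma hasE_shifted_step (p p' : 'I_n * 'I_n) (x : V * V) :
  hasE P (fun w => phi (step noshift k p' (x, noise B k w)) *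
                   gauss_lik R dim s (g p x.1) (noise B k w))
    (fine (\int[P]_w (phi (step g k p (x, noise B k w)))%:E)%E).
Proof.
pose psi (v : V) := phi (step noshift k p' (x, v)).
have mpsi : measurable_fun setT psi.
  apply: (measurableT_comp mphi).
  apply: (measurableT_comp (measurable_chain_step eta mproj (g := noshift) _ k p')).
    by move=> ?; exact: measurable_cst.
  exact: measurable_fun_pair.
have psi0 v : 0 <= psi v by case/andP: (phi01 (step noshift k p' (x, v))).
have mn := measurable_noise_t mB k.
apply: hasE_ge0.
- by move=> w; rewrite mulr_ge0 ?expR_ge0//; exact: psi0.
- apply: measurable_funM; first exact: (measurableT_comp mpsi mn).
  exact: (measurableT_comp (measurable_gauss_lik R dim s (g p x.1)) mn).
rewrite (step_fineK P mB eta mproj mg k mphi phi01 p x).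
transitivity (\int[P]_w (psi (noise B k w + g p x.1)%R)%:E)%E; last first.
  by apply: eq_integral => w _; rewrite /psi /chain_step /= add0r [g p _ + _]addrC.
rewrite (cameron_martin _ _ _ P _ (B k) s s0 (mB k) (lawB k) (fun A => @noise_box k A) (g p x.1) (fun v => (psi v)%:E)).
- by apply: eq_integral => w _; rewrite EFinM.
- exact/measurable_EFinP.
- by move=> v; rewrite lee_fin.
Qed.

End one_step.

Variables (gA gB : 'I_n * 'I_n -> V -> V) (i0 : 'I_n) (G tau l : R).
Hypothesis mgA : forall p, measurable_fun setT (gA p).
Hypothesis mgB : forall p, measurable_fun setT (gB p).
Hypothesis gAB : forall p x, p.1 != i0 -> p.2 != i0 -> gA p x = gB p x.
Hypothesis gAG : forall p x, W x -> vnorm (gA p x) <= G.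
Hypothesis gBG : forall p x, W x -> vnorm (gB p x) <= G.
Hypothesis n2 : (2 < n)%N.
Hypothesis tauP : 0 < tau <= 3 / 2.
Hypothesis tauG : 4 * G ^+ 2 <= tau * s ^+ 2.
Hypothesis l1 : 1 < l.
Hypothesis hyp : 2 / n%:R * l * expR (3 / 2 * tau * (l - 1)) <= tau / (1 + tau).

(** Restricted to states in W, where the gradients are bounded by G; the projection keeps the chain
    there. *)
Definition tangent_dominated (M : R) (phi phi' : V * V -> R) := forall (x : V * V) (r : R), W x.1 -> 0 < r ->
  l * r `^ (l - 1) * phi x <= M + (l - 1) * r `^ l * phi' x.

Let M1 := 1 + 7 / 2 * (2 / n%:R) ^+ 2 * (l * (l - 1)) * tau.

Lemma kernel_step_dominated k (M : R) (phi phi' : V * V -> R) : 0 <= M ->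
  measurable_fun setT phi -> (forall x : V * V, 0 <= phi x <= 1) ->
  measurable_fun setT phi' -> (forall x : V * V, 0 <= phi' x <= 1) ->
  tangent_dominated M phi phi' ->
  tangent_dominated (M * M1) (ker gA k phi) (ker gB k phi').
Proof.
move=> M0 mphi phi01 mphi' phi01' H x r Wx r0.
pose FA p := fine (\int[P]_w (phi (step gA k p (x, noise B k w)))%:E)%E.
pose FB p := fine (\int[P]_w (phi' (step gB k p (x, noise B k w)))%:E)%E.
pose D p := l * r `^ (l - 1) * FA p - (l - 1) * r `^ l * FB p.
suff : \sum_p wt p * D p <= M * M1.
  have -> : \sum_p wt p * D p =
      l * r `^ (l - 1) * ker gA k phi x - (l - 1) * r `^ l * ker gB k phi' x.
    rewrite /kernel_step !mulr_sumr -sumrB; apply: eq_bigr => p _.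
    by rewrite /D /FA /FB mulrBr !(mulrCA (wt p)).
  by rewrite lerBlDr.
apply: (offdiag_average (i0 := i0)) => // a u a1 a2 _.
have nn : 2 < n%:R :> R by rewrite ltr_nat.
have q0 : 0 < 2 / n%:R :> R by rewrite divr_gt0//; lra.
have q1 : 2 / n%:R < 1 :> R by rewrite ltr_pdivrMr ?mul1r//; lra.
have s2 : 0 < s ^+ 2 by rewrite exprn_even_gt0.
have dist (y z : V) : vnorm y <= G -> vnorm z <= G -> vdot (y - z) (y - z) / s ^+ 2 <= tau.
  by move=> hy hz; rewrite ler_pdivrMr// (le_trans (vdot_sub_le _ _ _ hy hz)).
pose Z (v : V) := step noshift k a (x, v).
have pc : forall (v : V) t, 0 < t ->
    l * t `^ (l - 1) * phi (Z v) <= M + (l - 1) * t `^ l * phi' (Z v).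
  by move=> v t t0; apply: H => //; exact: projW.
have hA := hasE_shifted_step k mgA mphi phi01 a a x.
have hA' := hasE_shifted_step k mgB mphi' phi01' a a x.
(* At a pair avoiding i0 both datasets give the same gradient, which centres the reference law. *)
rewrite -(gAB x.1 a1 a2) in hA'.
have hU := hasE_shifted_step k mgA mphi phi01 u a x.
have hU' := hasE_shifted_step k mgB mphi' phi01' u a x.
have hs : l * r `^ (l - 1) * ((1 - 2 / n%:R) * FA a + 2 / n%:R * FA u) <=
    M * M1 + (l - 1) * r `^ l * ((1 - 2 / n%:R) * FB a + 2 / n%:R * FB u).
  exact: (sampled_step s0 (noise_mgf k) tauP l1 q0 q1 hyp
    (dist _ _ (gAG u Wx) (gAG a Wx)) (dist _ _ (gBG u Wx) (gAG a Wx)) (dist _ _ (gAG u Wx) (gBG u Wx))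
    M0 pc hA hA' hU hU' r0).
move: hs; rewrite /D -lerBlDr; apply: le_trans; apply: eq_le_porder.
by move: (FA a) (FA u) (FB a) (FB u) (r `^ l) (r `^ (l - 1)) (2 / _) => *; ring.
Qed.

(** The last step is peeled off by passing to the images of the test functions under the kernels,
    which multiplies M by M1; the induction ends at the deterministic start, which lies in W. *)
Lemma chain_dominated k : forall (M : R) (phi phi' : V * V -> R) (m m' : R), 0 <= M ->
  measurable_fun setT phi -> (forall x : V * V, 0 <= phi x <= 1) ->
  measurable_fun setT phi' -> (forall x : V * V, 0 <= phi' x <= 1) ->
  tangent_dominated M phi phi' ->
  (\int[P]_w (phi (chain gA k w))%:E = m%:E)%E ->
  (\int[P]_w (phi' (chain gB k w))%:E = m'%:E)%E ->
  forall r : R, 0 < r -> l * r `^ (l - 1) * m <= M * M1 ^+ k + (l - 1) * r `^ l * m'.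
Proof.
have M10 : 0 <= M1.
  have [t0 _] := andP tauP; have l1' := l1.
  by rewrite addr_ge0// !mulr_ge0 ?sqr_ge0 ?(ltW t0)//; lra.
elim: k => [|k IH] M phi phi' m m' M0 mphi phi01 mphi' phi01' H hm hm' r r0.
  have cstE c : (\int[P]_w (cst c%:E) w = c%:E)%E.
    by rewrite integral_cst// [X in (_ * X)%E]probability_setT mule1.
  move: hm hm'; rewrite /= !cstE => -[<-] -[<-].
  by rewrite expr0 mulr1; apply: H.
have bndA := kernel_step_bounds mB eta mproj mgA wtP k.+1 mphi phi01 ^~ wt_sum1.
have bndB := kernel_step_bounds mB eta mproj mgB wtP k.+1 mphi' phi01' ^~ wt_sum1.
rewrite (chain_kernel mIJ mB indep eta mproj mgA wtP k mphi phi01) in hm.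
rewrite (chain_kernel mIJ mB indep eta mproj mgB wtP k mphi' phi01') in hm'.
rewrite exprS mulrA; apply: (IH _ _ _ _ _ _ _ bndA _ bndB _ hm hm') => //.
- by rewrite mulr_ge0.
- exact: measurable_kernel_step.
- exact: measurable_kernel_step.
- exact: kernel_step_dominated.
Qed.

Lemma chain_dp (Q : set (V * V)) k (beta eps : R) : measurable Q ->
  (7 / 2 * (2 / n%:R) ^+ 2 * (l * (l - 1)) * tau) *+ k <= (l - 1) * (beta * eps) ->
  fine (P (chain gA k @^-1` Q)) <=
    expR eps * fine (P (chain gB k @^-1` Q)) + expR (- ((l - 1) * ((1 - beta) * eps))).
Proof.
move=> mQ hk; set z := _ * tau in hk.
have ind g : (forall p, measurable_fun setT (g p)) ->
    (\int[P]_w (\1_Q (chain g k w))%:E = (fine (P (chain g k @^-1` Q)))%:E)%E.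
  move=> mg; have mc : measurable (chain g k @^-1` Q).
    by have := measurable_chain mIJ mB eta mproj mg k measurableT mQ; rewrite setTI.
  by rewrite fineK ?fin_num_measure// -[X in P X]setIT -integral_indic.
have mQ1 : measurable_fun setT (\1_Q : V * V -> R) by exact: measurable_indic.
have Q01 x : 0 <= (\1_Q x : R) <= 1 by rewrite indicE; case: (_ \in _); rewrite ?lexx ?ler01.
have [t0 _] := andP tauP; have l1' := l1.
apply: (dp_of_moment (l := l) (A := M1 ^+ k)) => //.
- by rewrite exprn_ge0// addr_ge0// !mulr_ge0 ?sqr_ge0 ?(ltW t0)//; lra.
- apply: (@le_trans _ _ (expR ((l - 1) * (beta * eps)) * expR (- (eps * (l - 1))))).
    rewrite ler_pM2r ?expR_gt0//; apply: (@le_trans _ _ (expR (z *+ k))); last by rewrite ler_expR.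
    rewrite -mulr_natr expRM_natr; apply: lerXn2r; rewrite ?nnegrE ?expR_ge0//; last exact: expR_ge1Dx.
    by rewrite addr_ge0// !mulr_ge0 ?sqr_ge0 ?(ltW t0)//; lra.
  by rewrite -expRD ler_expR; lra.
move=> r r0; rewrite -[M1 ^+ k]mul1r.
apply: (chain_dominated ler01 mQ1 Q01 mQ1 Q01 _ (ind _ mgA) (ind _ mgB) r0).
(* Both test functions are the same indicator, so M = 1 is enough: l t^(l-1) - (l-1) t^l <= 1 is
   Bernoulli's inequality at 1/t. *)
move=> x t _ tt0; rewrite indicE; case: (_ \in _); rewrite ?mulr1 ?mulr0 ?addr0//.
have t1 : 0 < t^-1 by rewrite invr_gt0.
have tl : t `^ l = t * t `^ (l - 1) by rewrite mulr_powRB1 ?(ltW tt0)//; lra.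
have := bernoulli_powR _ l t^-1 (ltW l1) t1.
have -> : t^-1 `^ l = (t `^ l)^-1 by rewrite -powR_inv1 ?(ltW tt0)// -powRrM mulN1r powRN.
rewrite -(ler_pM2l (powR_gt0 l tt0)) divff ?gt_eqF ?powR_gt0//.
have -> : t `^ l * (1 + l * (t^-1 - 1)) = t `^ l + l * (t / t * t `^ (l - 1) - t `^ l).
  by rewrite tl; ring.
rewrite divff ?gt_eqF// mul1r; lra.
Qed.

End privacy.

(** * Translation of the numerical hypotheses *)

Lemma alg2_parameters (R : realType) (G beta eps delta : R) (n T : nat) :
  (1 < n)%N -> (0 < T)%N -> 0 < beta < 1 -> 0 < eps -> 0 < delta < 1 ->
  let sigma2 := alg2_sigma2 G beta eps delta n T in
  let lambda := ln (delta^-1) / ((1 - beta) * eps) + 1 in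
  let tau := 4 * G ^+ 2 / sigma2 in
  268 / 100 * G ^+ 2 <= sigma2 ->
  lambda - 1 <= sigma2 / (6 * G ^+ 2) *
     ln (n%:R / (2 * lambda * (1 + sigma2 / (4 * G ^+ 2)))) ->
  [/\ 0 < sigma2, 0 < tau <= 3 / 2, 1 < lambda,
    2 / n%:R * lambda * expR (3 / 2 * tau * (lambda - 1)) <= tau / (1 + tau) &
    [/\ (2 < n)%N,
    7 / 2 * (2 / n%:R) ^+ 2 * (lambda * (lambda - 1)) * tau * T%:R = (lambda - 1) * (beta * eps) &
    expR (- ((lambda - 1) * ((1 - beta) * eps))) = delta]].
Proof.
move=> n1 T0 /andP[b0 b1] e0 /andP[d0 d1] sigma2 lambda tau hs hl.
have nR : 1 < n%:R :> R by rewrite ltr1n.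
have TR : 0 < T%:R :> R by rewrite ltr0n.
have be : 0 < (1 - beta) * eps by rewrite mulr_gt0//; lra.
have ld : 0 < ln (delta^-1) by rewrite ln_gt0// invf_gt1.
have l1 : 1 < lambda by rewrite /lambda ltrDr divr_gt0.
have sE : sigma2 = 56 * G ^+ 2 * T%:R / (beta * n%:R ^+ 2 * eps) * lambda by [].
(* For G = 0 the right side of the logarithmic hypothesis is 0, while lambda - 1 is positive. *)
have G0 : G != 0.
  apply/eqP => g0; move: hl; rewrite sE g0 expr0n/= !(mulr0, mul0r); lra.
have G2 : 0 < G ^+ 2 by rewrite exprn_even_gt0.
have s0 : 0 < sigma2 by lra.
have t0 : 0 < tau by rewrite divr_gt0//; lra.
have t1 : tau <= 3 / 2 by rewrite ler_pdivrMr//; lra.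
have snz : sigma2 != 0 by rewrite gt_eqF.
have h : 2 / n%:R * lambda * expR (3 / 2 * tau * (lambda - 1)) <= tau / (1 + tau).
  move: hl.
  have -> : sigma2 / (6 * G ^+ 2) = (3 / 2 * tau)^-1.
    by rewrite /tau; field; rewrite snz G0.
  have -> : 1 + sigma2 / (4 * G ^+ 2) = (1 + tau) / tau.
    by rewrite /tau; field; rewrite snz G0.
  have t3 : 0 < 3 / 2 * tau by rewrite mulr_gt0//; lra.
  rewrite ler_pdivlMl// => hl.
  have {hl} : expR (3 / 2 * tau * (lambda - 1)) <= n%:R / (2 * lambda * ((1 + tau) / tau)).
    rewrite -[leRHS]lnK ?ler_expR// posrE divr_gt0// ?mulr_gt0 ?invr_gt0//; move: nR l1 t0; clear; lra.
  have c0 : 0 < 2 / n%:R * lambda by rewrite mulr_gt0 ?divr_gt0//; move: nR l1; clear; lra.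
  rewrite -(ler_pM2l c0) => /le_trans; apply; apply: eq_le_porder.
  by field; rewrite !gt_eqF//; move: nR l1 t0; clear; lra.
split=> //; first by rewrite t0.
split.
(* 2/n is at most q l exp(...), which is at most tau/(1+tau) < 1. *)
- rewrite -(ltr_nat R); have n0 : 0 < n%:R :> R by lra.
  have ex : 1 <= expR (3 / 2 * tau * (lambda - 1)).
    rewrite -[leLHS]expR0 ler_expR; apply: mulr_ge0; last by rewrite subr_ge0 ltW.
    by apply: mulr_ge0; [rewrite divr_ge0|exact: ltW].
  have : tau / (1 + tau) < 1 by rewrite ltr_pdivrMr//; lra.
  move=> /(le_lt_trans h) q1.
  have : 2 / n%:R * 1 * 1 < 1 :> R.
    have q0 : 0 <= 2 / n%:R :> R by rewrite divr_ge0// ltW.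
    apply: le_lt_trans q1; apply: (ler_pM _ ler01 _ ex); first by rewrite mulr1.
    by apply: ler_wpM2l => //; exact: ltW.
  by rewrite !mulr1 ltr_pdivrMr// mul1r.
- rewrite /tau; clearbody sigma2 lambda; rewrite sE; field.
  by rewrite G0 !gt_eqF//; move: nR l1; clear; lra.
- by rewrite /lambda addrK divfK ?gt_eqF// expRN lnK ?posrE ?invr_gt0// invrK.
Qed.

(** * The algorithm as a chain *)

Section algorithm.
Context d (Omega : measurableType d) (R : realType) (dim n : nat).
Variables (IJ : nat -> Omega -> 'I_n * 'I_n) (B : nat -> 'I_dim -> Omega -> R).
Variables (proj : 'rV[R]_dim -> 'rV[R]_dim) (eta : nat -> R).
Variables (g : 'rV[R]_dim -> @datum R dim -> @datum R dim -> 'rV[R]_dim) (S : 'I_n -> @datum R dim).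

Definition pair_gradient (p : 'I_n * 'I_n) (w : @rVT R dim) : @rVT R dim := g w (S p.1) (S p.2).

Lemma chain_pair_gradient k w :
  chain IJ B proj eta pair_gradient k w =
  (alg2_iter proj g eta S (fun t => IJ t w) (fun t => \row_i B t i w) k,
   \sum_(j < k.+1) alg2_iter proj g eta S (fun t => IJ t w) (fun t => \row_i B t i w) j).
Proof.
elim: k => [|k IH]; first by rewrite big_ord_recr big_ord0 /= addr0.
by rewrite big_ord_recr /= IH.
Qed.

(** The average runs over w_1, ..., w_T with w_1 = 0, so only T - 1 steps enter the output. *)
Lemma alg2_output_chain T w : (0 < T)%N ->
  alg2_output proj g eta T IJ B S w =
  T%:R^-1 *: (chain IJ B proj eta pair_gradient T.-1 w).2.
Proof. by move=> T0; rewrite chain_pair_gradient /= prednK. Qed.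

End algorithm.

Unset Implicit Arguments.

Theorem theorem4 (R : realType) (dim n T : nat)
  (X : set 'rV[R]_dim) (Y : set R) (W : set 'rV[R]_dim)
  (f : 'rV[R]_dim -> datum dim -> datum dim -> R)
  (g : 'rV[R]_dim -> datum dim -> datum dim -> 'rV[R]_dim)
  (proj : 'rV[R]_dim -> 'rV[R]_dim) (eta : nat -> R)
  (G beta eps delta : R)
  (d : measure_display) (Omega : measurableType d) (P : probability Omega R)
  (IJ : nat -> Omega -> ('I_n * 'I_n)) (B : nat -> 'I_dim -> Omega -> R) :
  (1 < n)%N -> (0 < T)%N ->
  (* the domain W: convex, containing w_1 = 0, with Euclidean projection proj *)
  convex_subset W -> W 0 ->
  (forall x, W (proj x) /\ forall w, W w -> vnorm (proj x - x) <= vnorm (w - x)) ->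
  (* the pairwise loss: convex and G-Lipschitz in w on W *)
  (forall z z', (X `*` Y) z -> (X `*` Y) z' -> convex_on W (fun w => f w z z')) ->
  (forall z z', (X `*` Y) z -> (X `*` Y) z' -> forall w w', W w -> W w' ->
     `|f w z z' - f w' z z'| <= G * vnorm (w - w')) ->
  (* g is the (sub)gradient oracle of f in w *)
  (forall z z', (X `*` Y) z -> (X `*` Y) z' -> forall w v, W w -> W v ->
     f w z z' + vdot (g w z z') (v - w) <= f v z z') ->
  (forall z z', (X `*` Y) z -> (X `*` Y) z' -> forall w, W w ->
     vnorm (g w z z') <= G) ->
  (forall z z', rV_measurable_fun (fun w => g w z z')) ->
  (* privacy parameters *)
  0 < beta < 1 -> 0 < eps -> 0 < delta < 1 ->
  268 / 100 * G ^+ 2 <= alg2_sigma2 G beta eps delta n T ->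
  (let sigma2 := alg2_sigma2 G beta eps delta n T in
   let lambda := ln (delta^-1) / ((1 - beta) * eps) + 1 in
   lambda - 1 <= sigma2 / (6 * G ^+ 2) *
     ln (n%:R / (2 * lambda * (1 + sigma2 / (4 * G ^+ 2))))) ->
  (* randomness of Algorithm 2: (i_t, j_t) uniform over ordered pairs i <> j *)
  (forall t p, measurable (IJ t @^-1` [set p])) ->
  (forall t p, P (IJ t @^-1` [set p]) =
     (if p.1 != p.2 then (n * n.-1)%:R^-1 else 0)%:E) ->
  (* b_t ~ N(0, sigma^2 I_dim), coordinatewise *)
  (forall t k, measurable_fun setT (B t k)) ->
  (forall t k A, measurable A ->
     P (B t k @^-1` A) = normal_prob 0 (Num.sqrt (alg2_sigma2 G beta eps delta n T)) A) ->
  (* all of these are mutually independent *)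
  mutually_independent P (alg2_classes IJ B) ->
  differentially_private P (X `*` Y) (alg2_output proj g eta T IJ B) eps delta.

Proof.
move=> n1 T0 convW W0 projP _ _ _ gG mg b01 e0 d01 hs hl mIJ wtP mB lawB indep.
move=> S S' ZS ZS' [i0 [_ SS']] E mE.
move: hl => /=; set sigma2 := alg2_sigma2 _ _ _ _ _ _ in hs lawB *.
set lambda := _ / _ + 1 => hl.
have [s0 tauP l1 hyp [n2 hT hdelta]] := alg2_parameters n1 T0 b01 e0 d01 hs hl.
rewrite -/sigma2 -/lambda in s0 tauP l1 hyp hT hdelta.
set tau := 4 * _ / _ in tauP hyp hT.
pose s := Num.sqrt sigma2.
have sE : s ^+ 2 = sigma2 by rewrite sqr_sqrtr// ltW.
have sn0 : s != 0 by rewrite gt_eqF// sqrtr_gt0.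
have mgS (Q : 'I_n -> datum dim) p :
    measurable_fun setT (pair_gradient g Q p).
  by move=> _ A; rewrite setTI !rVT_measurableE => mA; exact: mg.
have mproj : measurable_fun setT (proj : @rVT R dim -> @rVT R dim) by exact: (measurable_proj W proj convW).
have gGS (Q : 'I_n -> datum dim) (ZQ : forall i, (X `*` Y) (Q i)) p x : W x ->
    vnorm (pair_gradient g Q p x) <= G by exact: gG.
have gSS p x : p.1 != i0 -> p.2 != i0 -> pair_gradient g S p x = pair_gradient g S' p x.
  by move=> p1 p2; rewrite /pair_gradient !SS'.
have tauG : 4 * G ^+ 2 <= tau * s ^+ 2 by rewrite sE /tau divfK ?gt_eqF.
clearbody tau lambda.
(* The event pulled back to the state of the chain: the output is the accumulated sum divided by
   T. *)
pose Q : set (@rVT R dim * @rVT R dim) := [set x | E (T%:R^-1 *: x.2)].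
have mQ : measurable Q.
  have ms : measurable_fun setT (fun x : @rVT R dim * @rVT R dim => (T%:R^-1 *: x.2 : @rVT R dim)).
    apply: measurable_fun_rV => i; under eq_fun do rewrite mxE.
    apply: measurable_funM => //.
    exact: (measurableT_comp (measurable_coord i) measurable_snd).
  have := ms measurableT E; rewrite setTI; apply; by rewrite rVT_measurableE.
have outE A : alg2_output proj g eta T IJ B A @^-1` E =
    chain IJ B proj eta (pair_gradient g A) T.-1 @^-1` Q.
  by apply/funext => w; rewrite /preimage /Q /= alg2_output_chain.
have z0 : 0 <= 7 / 2 * (2 / n%:R) ^+ 2 * (lambda * (lambda - 1)) * tau.
  by have [t0 _] := andP tauP; rewrite !mulr_ge0 ?sqr_ge0 ?(ltW t0)//; move: l1; clear; lra.
(* The variance is calibrated for T steps and T - 1 are taken. *)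
have hk : (7 / 2 * (2 / n%:R) ^+ 2 * (lambda * (lambda - 1)) * tau) *+ T.-1 <=
    (lambda - 1) * (beta * eps).
  by rewrite -hT -mulr_natr ler_wpM2l// ler_nat leq_pred.
have := chain_dp mIJ mB indep sn0 lawB eta mproj (fun x => (projP x).1) W0 wtP
  (mgS S) (mgS S') gSS (gGS S ZS) (gGS S' ZS') n2 tauP tauG l1 hyp mQ hk.
rewrite hdelta !outE -lee_fin EFinD EFinM.
have mc A : measurable (chain IJ B proj eta (pair_gradient g A) T.-1 @^-1` Q).
  by have := measurable_chain mIJ mB eta mproj (mgS A) T.-1 measurableT mQ; rewrite setTI.
by rewrite !fineK// fin_num_measure.
Qed.
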